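(* Let $(\Omega,\Sigma,\mu)$ be a measure space with $\mu:\Sigma\to[0,\infty]$ a locally determined positive measure, let $X$ be a Banach space over $\mathbb{K}$ ($\mathbb{R}$ or $\mathbb{C}$), let $F:\Omega\to X$ be locally Bochner integrable, and let $\nu_F:\Sigma^f\to X$ be the vector measure $\nu_F(B)=\mathbb{P}\text{-}\int_B F\,d\mu$, $B\in\Sigma^f$, with variation $|\nu_F|$. Let $g\in L^0(|\nu_F|)$. Then $g\in L^1(|\nu_F|)$ if and only if $gF\in\mathbb{B}(\mu,X)$. Moreover $M_F:L^1(|\nu_F|)\to\mathbb{B}(\mu,X)$, $M_F(g)=gF$, is a linear isometry such that $I_{\nu_F}(g)=I_{\mathbb{B}}(M_F(g))$ for all $g\in L^1(|\nu_F|)$, where $I_{\nu_F}(g)=\int_\Omega g\,d\nu_F$ and $I_{\mathbb{B}}(G)=\mathbb{B}\text{-}\int_\Omega G\,d\mu$ is the Bochner integral.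
   Context: $\Omega$ is a nonempty set, $\Sigma$ a $\sigma$-algebra on $\Omega$, $\Sigma^f=\{B\in\Sigma:\mu(B)<\infty\}$. $X^*$ is the dual of $X$ and $B_{X^*}$ its unit ball. $\mu$ is semi-finite if every $A\in\Sigma$ with $\mu(A)>0$ contains $B\in\Sigma^f$ with $\mu(B)>0$; $\mu$ is locally determined if it is semi-finite and $\Sigma=\{A\subset\Omega: A\cap B\in\Sigma\ \forall B\in\Sigma^f\}$. $L^0(\Sigma)$ denotes the $\Sigma$-measurable functions $\Omega\to\mathbb{K}$. Vector functions. $F:\Omega\to X$ is strongly $\mu$-measurable if it is the pointwise $\mu$-a.e. limit of a sequence of $X$-valued simple ($\Sigma$-measurable, finitely valued) functions whose supports have finite $\mu$-measure. Functions that agree $\mu$-a.e. with $\Sigma$-measurable ones are integrated in the obvious way. $\mathbb{B}(\mu,X)$ (Bochner integrable functions) is the space of strongly $\mu$-measurable $F$, identified when equal $\mu$-a.e., with $\|F\|_X\in L^1(\mu)$, normed by $\|F\|_1=\int_\Omega\|F\|_X\,d\mu$. $F$ is locally Bochner integrable if it is strongly $\mu$-measurable and $\chi_BF\in\mathbb{B}(\mu,X)$ for all $B\in\Sigma^f$. A Bochner integrable function $G$ is Pettis integrable with the same integral: $\mathbb{P}\text{-}\int_AG\,d\mu=\mathbb{B}\text{-}\int_AG\,d\mu$ is the unique $x_A\in X$ with $\langle x_A,x^*\rangle=\int_A\langle G,x^*\rangle d\mu$ for all $x^*\in X^*$. For $F$ locally Bochner integrable and $B\in\Sigma^f$, $\mathbb{P}\text{-}\int_BF\,d\mu:=\mathbb{P}\text{-}\int_B\chi_BF\,d\mu$.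 Integration with respect to a vector measure. $\Sigma^f$ is a $\delta$-ring (a ring closed under countable intersections), and $\{A\subset\Omega: A\cap B\in\Sigma^f\ \forall B\in\Sigma^f\}=\Sigma$ as $\mu$ is locally determined. A vector measure $\nu:\Sigma^f\to X$ is a set function with $\nu(\bigcup_nB_n)=\sum_n\nu(B_n)$ for every pairwise disjoint sequence in $\Sigma^f$ with union in $\Sigma^f$; a scalar measure is the case $X=\mathbb{K}$. The variation of $\nu$ (or of a scalar measure) is the measure on $\Sigma$ given by $|\nu|(A)=\sup\sum_j\|\nu(A_j)\|_X$ over finite families of pairwise disjoint sets $A_j\in\Sigma^f$, $A_j\subset A$. $L^0(|\nu|)$ is $L^0(\Sigma)$ modulo equality $|\nu|$-a.e., and $L^1(|\nu|)$ is the usual $L^1$-space of the positive measure $|\nu|$ with norm $\int_\Omega|g|\,d|\nu|$. For a scalar measure $\lambda$ on $\Sigma^f$, $L^1(\lambda):=L^1(|\lambda|)$, and $\int f\,d\lambda$ is the continuous linear extension to $L^1(|\lambda|)$ of $\sum_ja_j\chi_{A_j}\mapsto\sum_ja_j\lambda(A_j)$ ($A_j\in\Sigma^f$); $\int_Af\,d\lambda=\int f\chi_A\,d\lambda$. For $x^*\in X^*$, $\langle\nu,x^*\rangle(B)=\langle\nu(B),x^*\rangle$. A function $f\in L^0(\Sigma)$ is $\nu$-integrable if $f\in L^1(\langle\nu,x^*\rangle)$ for all $x^*\in X^*$ and for each $A\in\Sigma$ there is $x_A\in X$ with $\langle x_A,x^*\rangle=\int_Af\,d\langle\nu,x^*\rangle$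 for all $x^*\in X^*$; then $\int_Af\,d\nu:=x_A$. (Every $g\in L^1(|\nu|)$ is $\nu$-integrable.) ''Isometry'' means norm-preserving (not necessarily surjective). *)

(* Defs.v *)
From HB Require Import structures.
From mathcomp Require Import all_boot all_order all_algebra complex.
From mathcomp Require Import all_classical all_reals all_analysis.
From mathcomp Require Import measurable_realfun.

Set Implicit Arguments.
Unset Strict Implicit.
Unset Printing Implicit Defensive.
Import Order.TTheory GRing.Theory Num.Theory.
Import numFieldNormedType.Exports.
Local Open Scope classical_set_scope.
Local Open Scope ring_scope.

Variant scalar_kind := RealScalars | ComplexScalars.

(* The scalar field: R itself, or the complex numbers R[i] over R. *)
Definition scalar_field (R : realType) (k : scalar_kind) : numFieldType :=
  match k with RealScalars => R | ComplexScalars => R[i] end.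

Definition re_part (R : realType) (k : scalar_kind) : scalar_field R k -> R :=
  match k with RealScalars => id | ComplexScalars => @complex.Re R end.

Definition im_part (R : realType) (k : scalar_kind) : scalar_field R k -> R :=
  match k with RealScalars => fun=> 0 | ComplexScalars => @complex.Im R end.

Definition mk_scalar (R : realType) (k : scalar_kind) : R -> R -> scalar_field R k :=
  match k with RealScalars => fun a _ => a | ComplexScalars => @Complex R end.

(* Norms in a normedModType K are valued in K; [rnorm] is the R-valued norm. *)
Definition rnorm (R : realType) (k : scalar_kind)
  (V : normedModType (scalar_field R k)) (x : V) : R := re_part `|x|.

Section scalar_lemmas.
Variables (R : realType) (k : scalar_kind).
Local Notation K := (scalar_field R k).

Lemma re_partD (x y : K) : re_part (x + y) = re_part x + re_part y.
Proof. by case: k x y => //= -[a b] [c e]. Qed.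

Lemma le_re_part (x y : K) : x <= y -> re_part x <= re_part y.
Proof. by case: k x y => //= x y; rewrite lecE => /andP[]. Qed.

Lemma lt_re_part (x y : K) : x < y -> re_part x < re_part y.
Proof. by case: k x y => //= x y; rewrite ltcE => /andP[]. Qed.

Lemma re_part0 : re_part (0 : K) = 0.
Proof. by case: k. Qed.

Lemma re_partK (x : K) : 0 <= x -> mk_scalar k (re_part x) 0 = x.
Proof. by case: k x => //= -[a b]; rewrite lecE => /andP[/= /eqP -> _]. Qed.

Lemma re_partM (x y : K) : 0 <= x -> re_part (x * y) = re_part x * re_part y.
Proof.
case: k x y => //= -[a b] [c e]; rewrite lecE => /andP[/= /eqP -> _].
by rewrite mul0r subr0.
Qed.

Lemma mk_scalar_gt0 (e : R) : 0 < e -> (0 : K) < mk_scalar k e 0.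
Proof. by case: k => //= e0; rewrite ltcE /= eqxx. Qed.

Lemma re_mk_scalar (a b : R) : re_part (mk_scalar k a b) = a.
Proof. by case: k. Qed.

Lemma lt_mk_scalar (x e : K) : 0 <= x -> 0 <= e -> re_part x < re_part e -> x < e.
Proof.
case: k x e => //= -[a b] [c e]; rewrite !lecE !ltcE /= => /andP[/eqP -> _].
by move=> /andP[/eqP -> _] ->; rewrite eqxx.
Qed.

Section norm.
Variable V : normedModType K.
Implicit Types x y : V.

Lemma rnorm_ge0 x : 0 <= rnorm x.
Proof. by rewrite /rnorm -re_part0 le_re_part. Qed.

Lemma rnorm0 : rnorm (0 : V) = 0.
Proof. by rewrite /rnorm normr0 re_part0. Qed.

Lemma rnormN x : rnorm (- x) = rnorm x.
Proof. by rewrite /rnorm normrN. Qed.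

Lemma ler_rnormD x y : rnorm (x + y) <= rnorm x + rnorm y.
Proof. by rewrite /rnorm -re_partD le_re_part// ler_normD. Qed.

Lemma rnormZ (a : K) x : rnorm (a *: x) = rnorm (a : K^o) * rnorm x.
Proof. by rewrite /rnorm normrZ re_partM. Qed.

Lemma ler_dist_rnorm x y : `|rnorm x - rnorm y| <= rnorm (x - y).
Proof.
have tri (a b : V) : rnorm a <= rnorm b + rnorm (a - b).
  by rewrite (le_trans _ (ler_rnormD _ _))// addrC subrK.
rewrite ler_norml lerBlDl tri andbT lerBrDr addrC lerBlDr.
by rewrite addrC -(rnormN (x - y)) opprB addrC.
Qed.

Lemma rnorm_lt (x : V) (e : K) : 0 < e -> (`|x| < e) = (rnorm x < re_part e).
Proof.
move=> e0; apply/idP/idP; first exact: lt_re_part.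
by apply: lt_mk_scalar => //; exact: ltW.
Qed.

Lemma cvg_rnormB (I : Type) (G : set_system I) (FG : Filter G) (u : I -> V) l :
  u @ G --> l <-> forall e : R, 0 < e -> \forall n \near G, rnorm (l - u n) < e.
Proof.
split => [/cvgrPdist_lt ul e e0|ul].
  have := ul _ (mk_scalar_gt0 e0); apply: filterS => n.
  by rewrite rnorm_lt ?mk_scalar_gt0// re_mk_scalar.
apply/cvgrPdist_lt => e e0.
have e0' : 0 < re_part e by rewrite -re_part0 lt_re_part.
by have := ul _ e0'; apply: filterS => n; rewrite rnorm_lt.
Qed.

Lemma cvg_rnorm (I : Type) (G : set_system I) (FG : Filter G) (u : I -> V) l :
  u @ G --> l -> (fun n => rnorm (u n)) @ G --> rnorm l.
Proof.
move=> /cvg_rnormB ul; apply/cvgrPdist_lt => e e0.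
by have := ul _ e0; apply: filterS => n; apply: le_lt_trans; exact: ler_dist_rnorm.
Qed.

Lemma open_rnormP (U : set V) : open U <->
  forall x, U x -> exists2 e : R, 0 < e & forall y, rnorm (x - y) < e -> U y.
Proof.
rewrite openE; split=> [oU x Ux|oU x Ux].
  have /nbhs_ballP[/= e e0 eU] := oU _ Ux.
  exists (re_part e); first by rewrite -re_part0 lt_re_part.
  by move=> y xy; apply: eU; rewrite -ball_normE /= rnorm_lt.
have [e e0 eU] := oU _ Ux; apply/nbhs_ballP; exists (mk_scalar k e 0) => /=.
  exact: mk_scalar_gt0.
move=> y; rewrite -ball_normE /= rnorm_lt ?mk_scalar_gt0// re_mk_scalar.
exact: eU.
Qed.

Lemma open_rnorm_lt x (e : R) : open [set y | rnorm (x - y) < e].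
Proof.
apply/open_rnormP => y /= xy; exists (e - rnorm (x - y)); first by rewrite subr_gt0.
move=> z; rewrite ltrBrDl; apply: le_lt_trans.
by rewrite (le_trans _ (ler_rnormD _ _))// addrA addrNK.
Qed.

Lemma open_rnorm_gt (e : R) : open [set y : V | e < rnorm y].
Proof.
apply/open_rnormP => y /= ey; exists (rnorm y - e); first by rewrite subr_gt0.
move=> z; rewrite ltrBrDl -ltrBrDr => /lt_le_trans; apply.
by rewrite lerBlDr addrC (le_trans _ (ler_rnormD _ _))// addrNK.
Qed.

End norm.

Definition dense_seq (n : nat) : K :=
  let q : rat * rat := odflt (0, 0) (unpickle n) in
  mk_scalar k (ratr q.1) (ratr q.2).

Lemma dense_seqP (x : K) (e : R) : 0 < e ->
  exists n, rnorm (x - dense_seq n : K^o) < e.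
Proof.
move=> e0.
have H (a : R) (r : R) : 0 < r -> exists q : rat, `|a - ratr q| < r.
  move=> r0; have /rat_in_itvoo[q] : a - r < a + r by rewrite ltrBlDr -addrA ltrDl addr_gt0.
  by rewrite in_itv /= => qr; exists q; rewrite distrC ltr_distl.
have e2 : 0 < e / 2 by rewrite divr_gt0.
have [p pP] := H (re_part x) _ e2; have [q qP] := H (im_part x) _ e2.
exists (pickle (p, q)); rewrite /dense_seq pickleK /=.
rewrite /rnorm /=.
case: k x pP qP => /= [x xp _|[a b] /= ap bq].
  by rewrite (lt_trans xp)// ltr_pdivrMr// ltr_pMr// ltrDl.
suff : complex.Re `|((a - ratr p) +i* (b - ratr q))%C| < e by [].
rewrite normc_def /=.
set u := a - ratr p in ap *; set v := b - ratr q in bq *.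
apply: (@le_lt_trans _ _ (`|u| + `|v|)); last by rewrite [ltRHS]splitr ltrD.
have s0 : 0 <= `|u| + `|v| by rewrite addr_ge0.
rewrite -[leRHS](ger0_norm s0) -(sqrtr_sqr (`|u| + `|v|)) ler_wsqrtr//.
rewrite (sqrrD `|u| `|v|) !real_normK ?num_real// [leRHS]addrAC lerDl.
by rewrite mulrn_wge0// mulr_ge0.
Qed.

End scalar_lemmas.

Section scalar_measurable.
Context d (T : measurableType d) (R : realType) (k : scalar_kind).
Local Notation K := (scalar_field R k).

(* Measurability of a scalar function with respect to the Borel sets of K. *)
Definition scalar_measurable (f : T -> K) : Prop :=
  measurable_fun setT (f : T -> g_sigma_algebraType (@open K)).

Lemma scalar_measurableP (f : T -> K) :
  scalar_measurable f <-> forall U : set K, open U -> measurable (f @^-1` U).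
Proof.
split=> [mf U oU|mf].
  by rewrite -[X in measurable X]setTI; apply: mf => //; exact: sub_sigma_algebra.
apply: (@measurability _ _ T (g_sigma_algebraType (@open K)) setT f (@open K)) => //.
by move=> _ [U oU <-]; rewrite setTI; exact: mf.
Qed.

Lemma scalar_measurable_cst (a : K) : scalar_measurable (cst a).
Proof. exact: measurable_cst. Qed.

Lemma scalar_measurableD (f g : T -> K) : scalar_measurable f ->
  scalar_measurable g -> scalar_measurable (f \+ g).
Proof.
move=> /scalar_measurableP mf /scalar_measurableP mg.
apply/scalar_measurableP => U /(open_rnormP (V := K^o)) oU.
pose D := @dense_seq R k; pose B (a : K) n : set K :=
  [set y | rnorm (a - y : K^o) < n.+1%:R^-1].
pose P (t : nat * nat * nat) := forall a b, B (D t.1.1) t.2 a -> B (D t.1.2) t.2 b -> U (a + b).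
pose G (t : nat * nat * nat) : set T := if `[< P t >] then
  f @^-1` B (D t.1.1) t.2 `&` g @^-1` B (D t.1.2) t.2 else set0.
have -> : (f \+ g) @^-1` U = \bigcup_t G t.
  apply/seteqP; split=> [x /oU[e e0 eU]|x [t _]]; last first.
    by rewrite /G; case: asboolP => // Pt [] /= /Pt /[apply].
  have [n ne] : exists n, n.+1%:R^-1 < e / 4.
    have := @near_infty_natSinv_lt R (PosNum (divr_gt0 e0 (ltr0Sn R 3))).
    by case=> n _ /(_ n (leqnn _)) /=; exists n.
  have n0 : 0 < n.+1%:R^-1 :> R by rewrite invr_gt0.
  have [i iP] := dense_seqP (f x) n0; have [j jP] := dense_seqP (g x) n0.
  have Bf : B (D i) n (f x) by rewrite /B /= -rnormN opprB.
  have Bg : B (D j) n (g x) by rewrite /B /= -rnormN opprB.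
  exists (i, j, n) => //; rewrite /G; case: asboolP => // -[] a b /= Ba Bb.
  apply: eU => /=.
  have -> : f x + g x - (a + b) = (f x - D i) + ((D i - a) + ((g x - D j) + (D j - b))).
    by rewrite !addrA !subrK opprD addrA [f x + g x - a]addrAC.
  apply: (@lt_trans _ _ (n.+1%:R^-1 *+ 4)); last first.
    by rewrite -(mulr_natr _ 4) -ltr_pdivlMr.
  have -> (N : R) : N *+ 4 = N + (N + (N + N)) by rewrite !mulrS mulr0n addr0.
  apply: (le_lt_trans (ler_rnormD (V := K^o) _ _)); apply: ltrD => //.
  apply: (le_lt_trans (ler_rnormD (V := K^o) _ _)); apply: ltrD => //.
  by apply: (le_lt_trans (ler_rnormD (V := K^o) _ _)); apply: ltrD.
apply: countable_bigcupT_measurable => // -[[i j] n].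
rewrite /G; case: ifP => // _.
by apply: measurableI; [apply: mf|apply: mg]; exact: (open_rnorm_lt (V := K^o)).
Qed.

Lemma scalar_measurableZ (a : K) (f : T -> K) : scalar_measurable f ->
  scalar_measurable (fun x => a * f x).
Proof.
move=> /scalar_measurableP mf; apply/scalar_measurableP => U oU.
rewrite -[X in measurable X]/(f @^-1` ((fun y : K => a * y) @^-1` U)); apply: mf.
move/continuousP : (@mulrl_continuous K a); exact.
Qed.

Lemma measurable_rnorm (f : T -> K) : scalar_measurable f ->
  measurable_fun setT (fun x => rnorm (f x : K^o)).
Proof.
move=> /scalar_measurableP mf.
apply: (measurability _ (RGenOInfty.measurableE R)) => _ [_ [a ->] <-].
rewrite setTI -[X in measurable X]/(f @^-1` ((@rnorm R k K^o) @^-1` `]a, +oo[)).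
apply: mf; rewrite (_ : _ @^-1` _ = [set y : K^o | a < rnorm y]).
  exact: open_rnorm_gt.
by apply/seteqP; split=> y /=; rewrite in_itv /= andbT.
Qed.

End scalar_measurable.

Section finite_measure_sets.
Context d (T : measurableType d) (R : realType).
Variable mu : {measure set T -> \bar R}.

Definition finite_measure_sets : set (set T) :=
  [set B | measurable B /\ (mu B < +oo)%E].

Definition semi_finite : Prop := forall A, measurable A -> (0 < mu A)%E ->
  exists B, [/\ finite_measure_sets B, B `<=` A & (0 < mu B)%E].

Definition locally_determined : Prop := semi_finite /\
  measurable = [set A | forall B, finite_measure_sets B -> measurable (A `&` B)].

Lemma finite_measure_setsS (A B : set T) :
  finite_measure_sets B -> measurable A -> A `<=` B -> finite_measure_sets A.
Proof.
move=> [mB Boo] mA AB; split => //; apply: le_lt_trans Boo.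
by apply: le_measure => //; rewrite inE.
Qed.

Lemma finite_measure_sets0 : finite_measure_sets set0.
Proof. by split => //; rewrite measure0. Qed.

End finite_measure_sets.

Section vector_measure.
Context d (T : measurableType d) (R : realType) (k : scalar_kind).
Local Notation K := (scalar_field R k).
Variable mu : {measure set T -> \bar R}.

(* The values outside [finite_measure_sets mu] are irrelevant. *)
Record vector_measure (V : normedModType K) := VectorMeasure {
  vector_measure_fun :> set T -> V ;
  vector_measure_sigma_additive : forall B : (set T)^nat,
    (forall n, finite_measure_sets mu (B n)) -> trivIset setT B ->
    finite_measure_sets mu (\bigcup_n B n) ->
    (fun n => \sum_(i < n) vector_measure_fun (B i)) @ \oo -->
      vector_measure_fun (\bigcup_n B n) }.

Definition scalar_measure := vector_measure (K^o : normedModType K).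

Section variation.
Variables (V : normedModType K) (nu : vector_measure V).

(* Suprema over finite families in [finite_measure_sets mu]; meant on Sigma. *)
Definition vector_variation (A : set T) : \bar R :=
  ereal_sup [set s | exists n (B : 'I_n -> set T),
    [/\ forall i, finite_measure_sets mu (B i) /\ B i `<=` A,
        trivIset setT B &
        s = (\sum_(i < n) (rnorm (nu (B i)))%:E)%E]].

Lemma vector_measure0 : nu set0 = 0.
Proof.
have := @vector_measure_sigma_additive _ nu (fun=> set0)
  (fun=> finite_measure_sets0 mu) (@trivIset_set0 _ _ _).
rewrite bigcup0// => /(_ (finite_measure_sets0 mu)) /= h.
have h1 : (fun n => \sum_(i < n.+1) nu set0) @ \oo --> nu set0.
  have h' : (fun n => \sum_(i < n) nu set0) @ \oo --> nbhs (nu set0) := h.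
  by rewrite -cvg_shiftS in h'.
have h0 : (fun n => \sum_(i < n.+1) nu set0 - \sum_(i < n) nu set0) @ \oo -->
    nu set0 - nu set0 by exact: cvgB.
rewrite subrr in h0.
have cv0 : nu set0 @[_ --> \oo] --> nu set0 by exact: cvg_cst.
suff cv1 : nu set0 @[_ --> \oo] --> (0 : V).
  exact: (cvg_unique (@norm_hausdorff _ V) cv0 cv1).
apply: cvg_trans h0; apply: near_eq_cvg; apply: nearW => n /=.
by rewrite big_ord_recr /= addrAC subrr add0r.
Qed.

Lemma variation_ge0 A : (0 <= vector_variation A)%E.
Proof.
apply: ereal_sup_ubound; exists 0%N, (fun=> set0); split => //.
- by move=> [].
- by move=> [].
- by rewrite big_ord0.
Qed.

Lemma variation0 : vector_variation set0 = 0%E.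
Proof.
apply/eqP; rewrite eq_le variation_ge0 andbT.
apply: ge_ereal_sup => _ [n [B [fB _ ->]]].
rewrite big1// => i _; have [_] := fB i; rewrite subset0 => ->.
by rewrite vector_measure0 rnorm0.
Qed.

Lemma le_variation A B : A `<=` B -> (vector_variation A <= vector_variation B)%E.
Proof.
move=> AB; apply: le_ereal_sup => _ [n [C [fC tC ->]]].
exists n, C; split => // i; have [? CA] := fC i; split => //.
exact: subset_trans AB.
Qed.

Lemma variationU A B : A `&` B = set0 ->
  (vector_variation A + vector_variation B <= vector_variation (A `|` B))%E.
Proof.
move=> AB0.
have [->|VAoo] := eqVneq (vector_variation (A `|` B)) +oo%E; first exact: leey.
have fin C : C `<=` A `|` B -> vector_variation C \is a fin_num.
  move=> /le_variation CAB; rewrite ge0_fin_numE ?variation_ge0//.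
  by rewrite (le_lt_trans CAB)// ltey.
rewrite -leeBrDr ?fin//.
apply: ge_ereal_sup => _ [n [B' [fB tB ->]]].
have sfin m (D : 'I_m -> set T) :
  (\sum_(i < m) (rnorm (nu (D i)))%:E)%E \is a fin_num by rewrite sumEFin.
rewrite leeBrDr ?fin//.
rewrite addeC -leeBrDr ?sfin//.
apply: ge_ereal_sup => _ [m [C [fC tC ->]]].
rewrite leeBrDr ?sfin//.
pose D (i : 'I_(m + n)) := match fintype.split i with inl j => C j | inr j => B' j end.
have Dl j : D (lshift n j) = C j by rewrite /D (fintype.unsplitK (inl j)).
have Dr j : D (rshift m j) = B' j by rewrite /D (fintype.unsplitK (inr j)).
apply: ereal_sup_ubound; exists (m + n)%N, D; split.
- move=> i; rewrite -(fintype.splitK i); case: (fintype.split i) => j /=.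
    rewrite Dl; have [fj jB] := fC j; split => //.
    by apply: subset_trans jB _; exact: subsetUr.
  rewrite Dr; have [fj jA] := fB j; split => //.
  by apply: subset_trans jA _; exact: subsetUl.
- move=> i j _ _; rewrite -(fintype.splitK i) -(fintype.splitK j).
  case: (fintype.split i) => i'; case: (fintype.split j) => j' /=; rewrite ?Dl ?Dr.
  + by move=> /(tC _ _ I I) ->.
  + move=> [x [Cx Bx]]; exfalso.
    by rewrite -[False]/(set0 x) -AB0; split; [apply: (fB j').2|apply: (fC i').2].
  + move=> [x [Bx Cx]]; exfalso.
    by rewrite -[False]/(set0 x) -AB0; split; [apply: (fB i').2|apply: (fC j').2].
  + by move=> /(tB _ _ I I) ->.
- by rewrite big_split_ord; congr (_ + _)%E; apply: eq_bigr => i _; rewrite ?Dl ?Dr.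
Qed.

Lemma rnorm_le_nneseries (A : (set T)^nat) B : finite_measure_sets mu B ->
  (forall n, measurable (A n)) -> trivIset setT A -> B `<=` \bigcup_n A n ->
  ((rnorm (nu B))%:E <= \sum_(n <oo) (rnorm (nu (B `&` A n)))%:E)%E.
Proof.
move=> fB mA tA BA.
have BE : \bigcup_n (B `&` A n) = B by rewrite -setI_bigcupr; exact: setIidl.
have fBA n : finite_measure_sets mu (B `&` A n).
  by apply: (finite_measure_setsS fB) => //; apply: measurableI => //; case: fB.
have := @vector_measure_sigma_additive _ nu (fun n => B `&` A n) fBA.
rewrite BE => /(_ (@trivIset_setIl _ _ _ _ (fun=> B) tA) fB) /cvg_rnorm h.
have {}h : (fun n => (rnorm (\sum_(i < n) nu (B `&` A i)))%:E) @ \oo -->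
    (rnorm (nu B))%:E by apply: cvg_EFin; [exact: nearW|exact: h].
rewrite -(cvg_lim _ h)//; apply: lime_le; first by apply/cvg_ex; eexists; exact: h.
apply: nearW => n.
apply: le_trans (nneseries_lim_ge n _) => //; last by move=> i _ _; rewrite lee_fin rnorm_ge0.
rewrite sumEFin lee_fin big_mkord.
elim: n => [|n ih]; first by rewrite !big_ord0 rnorm0.
by rewrite !big_ord_recr /= (le_trans (ler_rnormD _ _))// lerD2r.
Qed.

Lemma variation_sigma_additive : semi_sigma_additive vector_variation.
Proof.
move=> A mA tA mUA.
have v0 n : (0 <= vector_variation (A n))%E by exact: variation_ge0.
suff <- : (\sum_(n <oo) vector_variation (A n) = vector_variation (\bigcup_n A n))%E.
  by apply: is_cvg_nneseries => n _ _.
apply/eqP; rewrite eq_le; apply/andP; split.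
  apply: lime_le; first by apply: is_cvg_nneseries => n _ _.
  apply: nearW => n.
  apply: (@le_trans _ _ (vector_variation (\big[setU/set0]_(i < n) A i))); last first.
    by apply: le_variation; exact: bigsetU_bigcup.
  elim: n => [|n ih]; first by rewrite big_geq// big_ord0 variation0.
  rewrite big_nat_recr//= big_ord_recr /=.
  apply: le_trans (variationU _); first by rewrite leeD2r.
  by apply: (@trivIset_bigsetUI _ predT A _ n n) => //; exact: sub_trivIset tA.
apply: ge_ereal_sup => _ [n [B [fB tB ->]]].
apply: (@le_trans _ _ (\sum_(i < n) \sum_(j <oo) (rnorm (nu (B i `&` A j)))%:E)%E).
  apply: lee_sum => i _; have [fi BA] := fB i.
  exact: rnorm_le_nneseries.
rewrite -nneseries_sum; last by move=> i j _; rewrite lee_fin rnorm_ge0.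
apply: lee_nneseries => [j _ _|j _].
  by apply: sume_ge0 => i _; rewrite lee_fin rnorm_ge0.
apply: ereal_sup_ubound; exists n, (fun i => B i `&` A j); split => //.
- move=> i; split => [|x []//]; have [fi _] := fB i.
  by apply: (finite_measure_setsS fi) => //; apply: measurableI => //; case: fi.
- exact: trivIset_setIr.
Qed.

HB.instance Definition _ := isMeasure.Build _ _ _ vector_variation
  variation0 variation_ge0 variation_sigma_additive.

End variation.
End vector_measure.

Section aefun.
Local Open Scope quotient_scope.
Context d (T : measurableType d) (R : realType) (mu : {measure set T -> \bar R}).
Context (K : pzRingType) (V : lmodType K).

Definition ae_equiv (f g : T -> V) : bool := `[< f = g %[ae mu] >].

Lemma ae_equiv_refl : reflexive ae_equiv.
Proof. by move=> f; apply/asboolP; exact: aeW. Qed.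

Lemma ae_equiv_sym : symmetric ae_equiv.
Proof.
by move=> f g; apply/asboolP/asboolP; apply: filterS => x /[apply] ->.
Qed.

Lemma ae_equiv_trans : transitive ae_equiv.
Proof.
move=> g f h /asboolP fg /asboolP gh; apply/asboolP.
by apply: filterS2 fg gh => x fgx ghx Dx; rewrite fgx// ghx.
Qed.

Canonical ae_equiv_canonical :=
  EquivRel ae_equiv ae_equiv_refl ae_equiv_sym ae_equiv_trans.

(* Functions T -> V modulo equality mu-almost everywhere. *)
Definition aefun : Type := {eq_quot ae_equiv}.
HB.instance Definition _ := Choice.on aefun.
HB.instance Definition _ := EqQuotient.on aefun.

Definition aeclass (f : T -> V) : aefun := \pi_aefun f.

Lemma aeclassP (f g : T -> V) : aeclass f = aeclass g <-> f = g %[ae mu].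
Proof. by split=> [/eqmodP /asboolP //|fg]; apply/eqmodP/asboolP. Qed.

Lemma aeclassK (p : aefun) : aeclass (repr p) = p.
Proof. exact: reprK. Qed.

Lemma repr_aeclass (f : T -> V) : repr (aeclass f) = f %[ae mu].
Proof. by apply/aeclassP; exact: aeclassK. Qed.

Definition aefun_add (p q : aefun) : aefun := aeclass (repr p \+ repr q).
Definition aefun_opp (p : aefun) : aefun := aeclass (\- repr p).
Definition aefun_scale (a : K) (p : aefun) : aefun := aeclass (a \*: repr p).

Lemma aeclass_add f g : aefun_add (aeclass f) (aeclass g) = aeclass (f \+ g).
Proof.
apply/aeclassP; apply: filterS2 (repr_aeclass f) (repr_aeclass g) => x /= fx gx _.
by rewrite fx// gx.
Qed.

Lemma aeclass_opp f : aefun_opp (aeclass f) = aeclass (\- f).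
Proof. by apply/aeclassP; apply: filterS (repr_aeclass f) => x /= fx _; rewrite fx. Qed.

Lemma aeclass_scale a f : aefun_scale a (aeclass f) = aeclass (a \*: f).
Proof. by apply/aeclassP; apply: filterS (repr_aeclass f) => x /= fx _; rewrite fx. Qed.

Lemma aefun_addA : associative aefun_add.
Proof.
move=> p q r; rewrite -(aeclassK p) -(aeclassK q) -(aeclassK r) !aeclass_add.
by congr aeclass; apply/funext => x /=; rewrite addrA.
Qed.

Lemma aefun_addC : commutative aefun_add.
Proof.
move=> p q; rewrite -(aeclassK p) -(aeclassK q) !aeclass_add.
by congr aeclass; apply/funext => x /=; rewrite addrC.
Qed.

Lemma aefun_add0 : left_id (aeclass (cst 0)) aefun_add.
Proof.
move=> p; rewrite -(aeclassK p) !aeclass_add.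
by congr aeclass; apply/funext => x /=; rewrite add0r.
Qed.

Lemma aefun_addN : left_inverse (aeclass (cst 0)) aefun_opp aefun_add.
Proof.
move=> p; rewrite -(aeclassK p) aeclass_opp !aeclass_add.
by congr aeclass; apply/funext => x /=; rewrite addNr.
Qed.

HB.instance Definition _ := GRing.isZmodule.Build aefun
  aefun_addA aefun_addC aefun_add0 aefun_addN.

Lemma aeclassD f g : aeclass f + aeclass g = aeclass (fun x => f x + g x).
Proof. exact: aeclass_add. Qed.

Lemma aefun_scaleA a b p : aefun_scale a (aefun_scale b p) = aefun_scale (a * b) p.
Proof.
rewrite -(aeclassK p) !aeclass_scale.
by congr aeclass; apply/funext => x /=; rewrite scalerA.
Qed.

Lemma aefun_scale1 : left_id 1 aefun_scale.
Proof.
move=> p; rewrite -(aeclassK p) !aeclass_scale.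
by congr aeclass; apply/funext => x /=; rewrite scale1r.
Qed.

Lemma aefun_scaleDr : right_distributive aefun_scale +%R.
Proof.
move=> a p q; rewrite -(aeclassK p) -(aeclassK q).
rewrite [X in aefun_scale a X]aeclassD !aeclass_scale aeclassD.
by congr aeclass; apply/funext => x /=; rewrite scalerDr.
Qed.

Lemma aefun_scaleDl p : {morph aefun_scale^~ p : a b / a + b}.
Proof.
move=> a b; rewrite -(aeclassK p) !aeclass_scale aeclassD.
by congr aeclass; apply/funext => x /=; rewrite scalerDl.
Qed.

HB.instance Definition _ := GRing.Zmodule_isLmodule.Build K aefun
  aefun_scaleA aefun_scale1 aefun_scaleDr aefun_scaleDl.

Lemma aeclass0 : 0 = aeclass (fun=> 0).
Proof. by []. Qed.

Lemma aeclassZ a f : a *: aeclass f = aeclass (fun x => a *: f x).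
Proof. exact: aeclass_scale. Qed.

End aefun.

Section integrals.
Context d (T : measurableType d) (R : realType) (mu : {measure set T -> \bar R}).
Import HBNNSimple.

(* The integral \int[mu] does not see null sets, even on functions that are only
   almost everywhere equal to measurable ones. *)
Lemma ge0_integral_ae_measurable (f h : T -> R) :
  (forall x, 0 <= f x) -> (forall x, 0 <= h x) -> measurable_fun setT h ->
  f = h %[ae mu] ->
  (\int[mu]_x (f x)%:E = \int[mu]_x (h x)%:E)%E.
Proof.
move=> f0 h0 mh [N [mN N0 fhN]].
have fhE x : ~ N x -> f x = h x.
  by move=> Nx; apply: contrapT => fh; apply: Nx; apply: fhN => /(_ I).
have mCN : measurable (~` N) by exact: measurableC.
pose g (u : T -> R) x := u x * \1_(~` N) x.
have g0 (u : T -> R) : (forall x, 0 <= u x) -> forall x, 0 <= g u x.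
  by move=> u0 x; rewrite /g mulr_ge0// ?u0// indicE.
have gle (u v : T -> R) : (forall x, 0 <= v x) -> (forall x, ~ N x -> u x <= v x) ->
    forall x, g u x <= v x.
  move=> v0 uv x; rewrite /g indicE; case: (boolP (x \in _)) => [|_]; last by rewrite mulr0.
  by rewrite inE => /uv; rewrite mulr1.
have mg (u : T -> R) : measurable_fun setT u -> measurable_fun setT (g u).
  by move=> mu_; apply: measurable_funM => //; exact: measurable_indic.
have gint (u : T -> R) : (forall x, 0 <= u x) -> measurable_fun setT u ->
    (\int[mu]_x (u x)%:E = \int[mu]_x (g u x)%:E)%E.
  move=> u0 mu_; apply: ge0_ae_eq_integral => //.
  - exact/measurable_EFinP.
  - by apply/measurable_EFinP; exact: mg.
  - by move=> x _; rewrite lee_fin.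
  - by move=> x _; rewrite lee_fin g0.
  - exists N; split => // x /=; apply: contra_notP => Nx _.
    by rewrite /g indicE mem_set// mulr1.
apply/eqP; rewrite eq_le; apply/andP; split.
  rewrite ge0_integralTE; last by move=> x; rewrite lee_fin.
  apply: ge_ereal_sup => _ [s sf <-].
  have s0 x : 0 <= s x by exact: fun_ge0.
  have ms : measurable_fun setT s by exact: measurable_funPT.
  rewrite -integralT_nnsfun (gint s)//.
  apply: ge0_le_integral => //.
  - by move=> x _; rewrite lee_fin g0.
  - by apply/measurable_EFinP; exact: mg.
  - exact/measurable_EFinP.
  - move=> x _; rewrite lee_fin; apply: gle => // y Ny.
    by rewrite -fhE// -lee_fin.
rewrite (gint h)// ge0_integralTE; last by move=> x; rewrite lee_fin g0.
rewrite [leRHS]ge0_integralTE; last by move=> x; rewrite lee_fin.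
apply: le_ereal_sup => _ [s sf <-]; exists s => // x.
by apply: le_trans (sf x) _; rewrite lee_fin; apply: gle => // y /fhE ->.
Qed.

(* [integrable] asks for measurability; membership in L^1(mu) of a function that
   is only almost everywhere equal to a measurable one. *)
Definition ae_integrable (f : T -> R) : Prop :=
  exists2 h : T -> R, mu.-integrable setT (EFin \o h) & f = h %[ae mu].

Lemma ae_integrable_le (f g : T -> R) :
  (exists2 h : T -> R, measurable_fun setT h & f = h %[ae mu]) ->
  ae_integrable g -> (forall x, `|f x| <= g x) -> ae_integrable f.
Proof.
move=> [h mh fh] [l il gl] fg; exists h => //.
apply/integrableP; split; first exact/measurable_EFinP.
have /integrableP[/measurable_EFinP ml loo] := il.
apply: le_lt_trans loo; apply: ae_ge0_le_integral => //.
- by apply/measurable_EFinP; exact: measurableT_comp.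
- by apply/measurable_EFinP; exact: measurableT_comp.
- apply: filterS2 fh gl => x /(_ I) fhx /(_ I) glx _ /=.
  by rewrite -fhx -glx lee_fin (le_trans (fg x))// ler_norm.
Qed.

Lemma ae_integrableD (f g : T -> R) :
  ae_integrable f -> ae_integrable g -> ae_integrable (fun x => f x + g x).
Proof.
move=> [h ih fh] [l il gl]; exists (fun x => h x + l x).
  have -> : EFin \o (fun x => h x + l x) = ((EFin \o h) \+ (EFin \o l))%E by [].
  exact: integrableD.
by apply: filterS2 fh gl => x fhx glx Dx; rewrite fhx// glx.
Qed.

Lemma ae_integrableZ (a : R) (f : T -> R) :
  ae_integrable f -> ae_integrable (fun x => a * f x).
Proof.
move=> [h ih fh]; exists (fun x => a * h x).
  exact: (integrableZl measurableT a ih).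
by apply: filterS fh => x /[apply] ->.
Qed.

End integrals.

Section spaces.
Context d (T : measurableType d) (R : realType) (k : scalar_kind).
Local Notation K := (scalar_field R k).
Variable mu : {measure set T -> \bar R}.

Section bochner.
Variable X : normedModType K.
Implicit Types F G : T -> X.

Definition simple_fun F : Prop :=
  [/\ finite_set (range F), forall v, measurable (F @^-1` [set v]) &
      finite_measure_sets mu (F @^-1` [set~ 0])].

Definition strongly_measurable F : Prop :=
  exists2 s : (T -> X)^nat, forall n, simple_fun (s n) &
    {ae mu, forall x, s ^~ x @ \oo --> F x}.

Definition bochner_integrable F : Prop :=
  strongly_measurable F /\ ae_integrable mu (fun x => rnorm (F x)).

Lemma simple_fun_preimage F (A : set X) :
  simple_fun F -> measurable (F @^-1` A).
Proof.
move=> [fF mF _].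
have -> : F @^-1` A = \bigcup_(v in range F `&` A) (F @^-1` [set v]).
  apply/seteqP; split=> [x Ax|x [v [_ Av] /= ->]//].
  by exists (F x).
by apply: fin_bigcup_measurable => //; exact: finite_setIl.
Qed.

Lemma simple_fun0 : simple_fun (fun=> 0).
Proof.
split.
- by apply: (@sub_finite_set _ _ [set 0]) => // _ [x _ <-].
- move=> v; rewrite -[X in measurable X]/(cst 0 @^-1` [set v]).
  by rewrite preimage_cst; case: ifP.
- rewrite (_ : _ @^-1` _ = set0); first exact: finite_measure_sets0.
  by apply/seteqP; split => x //=.
Qed.

Lemma simple_fun_lin (a : K) F G : simple_fun F -> simple_fun G ->
  simple_fun (fun x => a *: F x + G x).
Proof.
move=> sF sG; have [fF mF F0] := sF; have [fG mG G0] := sG.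
have mH A : measurable ((fun x => a *: F x + G x) @^-1` A).
  have -> : (fun x => a *: F x + G x) @^-1` A =
      \bigcup_(p in range F `*` range G) (F @^-1` [set p.1] `&` G @^-1` [set p.2] `&` [set x | A (a *: p.1 + p.2)]).
    apply/seteqP; split=> [x /= Ax|x [p _ /= [[-> ->]]]//].
    by exists (F x, G x) => //=; split; exists x.
  apply: fin_bigcup_measurable; first exact: finite_setX.
  move=> p _; apply: measurableI; first by apply: measurableI; exact: simple_fun_preimage.
  have [Ap|nAp] := pselect (A (a *: p.1 + p.2)).
    by rewrite (_ : [set _ | _] = setT)//; apply/seteqP; split.
  by rewrite (_ : [set _ | _] = set0)//; apply/seteqP; split.
split => [|v|].
- apply: (@sub_finite_set _ _ [set a *: u + v | u in range F & v in range G]).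
    by move=> _ [x _ <-]; exists (F x) => //; exists (G x).
  exact: finite_image2.
- exact: mH.
- apply: (@finite_measure_setsS _ _ _ _ _ (F @^-1` [set~ 0] `|` G @^-1` [set~ 0])).
  + case: F0 => mF0 F0; case: G0 => mG0 G0; split; first exact: measurableU.
    by rewrite (le_lt_trans (measureU2 _ _ _))// lte_add_pinfty.
  + exact: mH.
  + move=> x /= h; apply: contrapT => /not_orP[/contrapT /= F0x /contrapT /= G0x].
    by apply: h; rewrite F0x G0x scaler0 addr0.
Qed.

Lemma strongly_measurable0 : strongly_measurable (fun=> 0).
Proof.
exists (fun=> fun=> 0) => [n|]; first exact: simple_fun0.
by apply: aeW => x; exact: cvg_cst.
Qed.

Lemma strongly_measurable_lin (a : K) F G :
  strongly_measurable F -> strongly_measurable G ->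
  strongly_measurable (fun x => a *: F x + G x).
Proof.
move=> [s ss sF] [t st tG]; exists (fun n x => a *: s n x + t n x).
  by move=> n; exact: simple_fun_lin.
apply: filterS2 sF tG => x sx tx; apply: cvgD => //.
exact: (@cvgZl_tmp _ _ _ _ _ a _ _ sx).
Qed.

Lemma strongly_measurable_rnorm F : strongly_measurable F ->
  exists2 h : T -> R, measurable_fun setT h & (fun x => rnorm (F x)) = h %[ae mu].
Proof.
move=> [s ss [N [mN N0 sN]]].
have sE x : ~ N x -> s ^~ x @ \oo --> F x.
  by move=> Nx; apply: contrapT => sF; apply: Nx; exact: sN.
have mCN : measurable (~` N) by exact: measurableC.
exists (fun x => rnorm (F x) * \1_(~` N) x).
  apply: (@measurable_fun_cvg _ _ _ setT (fun n x => rnorm (s n x) * \1_(~` N) x)).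
    move=> n; apply: measurable_funM; last exact: measurable_indic.
    move=> _ Y mY; rewrite setTI.
    exact: (@simple_fun_preimage _ (@rnorm R k X @^-1` Y)).
  move=> x _; have [Nx|Nx] := pselect (N x).
    have -> : \1_(~` N) x = 0 :> R by rewrite indicE memNset.
    by rewrite mulr0; under eq_fun do rewrite mulr0; exact: cvg_cst.
  have -> : \1_(~` N) x = 1 :> R by rewrite indicE mem_set.
  by rewrite mulr1; under eq_fun do rewrite mulr1; exact: cvg_rnorm (sE _ Nx).
exists N; split => // x /=; apply: contra_notP => Nx _.
by rewrite indicE mem_set// mulr1.
Qed.

Lemma bochner_integrable0 : bochner_integrable (fun=> 0).
Proof.
split; first exact: strongly_measurable0.
exists (cst 0); last by apply: aeW => x _; rewrite rnorm0.
exact: integrable0.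
Qed.

Lemma bochner_integrable_lin (a : K) F G :
  bochner_integrable F -> bochner_integrable G ->
  bochner_integrable (fun x => a *: F x + G x).
Proof.
move=> [sF iF] [sG iG].
have sH := strongly_measurable_lin a sF sG; split => //.
apply: ae_integrable_le (strongly_measurable_rnorm sH)
  (ae_integrableD (ae_integrableZ (rnorm (a : K^o)) iF) iG) _ => x.
by rewrite ger0_norm ?rnorm_ge0// (le_trans (ler_rnormD _ _))// rnormZ.
Qed.

Definition bochner_pred : {pred aefun mu X} :=
  fun p => `[< exists2 F, bochner_integrable F & p = aeclass mu F >].

Lemma bochner_submod_closed : submod_closed bochner_pred.
Proof.
split.
  by apply/asboolP; exists (fun=> 0); [exact: bochner_integrable0|exact: aeclass0].
move=> a p q /asboolP[F iF ->] /asboolP[G iG ->]; apply/asboolP.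
exists (fun x => a *: F x + G x); first exact: bochner_integrable_lin.
by rewrite aeclassZ aeclassD.
Qed.

HB.instance Definition _ :=
  GRing.isSubmodClosed.Build K (aefun mu X) bochner_pred bochner_submod_closed.

(* The space of Bochner integrable functions modulo equality mu-a.e. *)
Record bochner := Bochner {
  bochner_val :> aefun mu X; bochner_valP : bochner_val \in bochner_pred }.

HB.instance Definition _ := [isSub for bochner_val].
HB.instance Definition _ := [Choice of bochner by <:].
HB.instance Definition _ := [SubChoice_isSubLmodule of bochner by <:].
End bochner.

Definition L1_fun (f : T -> K) : Prop :=
  scalar_measurable f /\ (\int[mu]_x (rnorm (f x : K^o))%:E < +oo)%E.

Lemma L1_fun_integrable f : scalar_measurable f -> L1_fun f <->
  mu.-integrable setT (fun x => (rnorm (f x : K^o))%:E).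
Proof.
move=> mf; have E : (\int[mu]_x `|(rnorm (f x : K^o))%:E| = \int[mu]_x (rnorm (f x : K^o))%:E)%E.
  by apply: eq_integral => x _; rewrite gee0_abs// lee_fin rnorm_ge0.
split=> [[_ foo]|/integrableP[_]]; last by rewrite E; split.
by apply/integrableP; split; [apply/measurable_EFinP; exact: measurable_rnorm|rewrite E].
Qed.

Lemma L1_fun0 : L1_fun (fun=> 0).
Proof.
split; first exact: scalar_measurable_cst.
by under eq_integral do rewrite rnorm0; rewrite integral0.
Qed.

Lemma L1_fun_lin (a : K) f g : L1_fun f -> L1_fun g ->
  L1_fun (fun x => a * f x + g x).
Proof.
move=> lf lg; have [mf _] := lf; have [mg _] := lg.
have mh : scalar_measurable (fun x => a * f x + g x).
  by apply: scalar_measurableD => //; exact: scalar_measurableZ.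
apply/(L1_fun_integrable mh).
have /(L1_fun_integrable mf) jf := lf; have /(L1_fun_integrable mg) jg := lg.
have jag := integrableD measurableT (integrableZl measurableT (rnorm (a : K^o)) jf) jg.
apply: le_integrable jag => //.
  by apply/measurable_EFinP; exact: measurable_rnorm.
move=> x _ /=; rewrite lee_fin !ger0_norm ?rnorm_ge0//; last first.
  by rewrite addr_ge0// ?mulr_ge0 ?rnorm_ge0.
by rewrite (le_trans (ler_rnormD (V := K^o) _ _))// lerD2r (rnormZ (V := K^o)).
Qed.

Definition L1_pred : {pred aefun mu (K^o : normedModType K)} :=
  fun p => `[< exists2 f, L1_fun f & p = aeclass mu (f : T -> K^o) >].

Lemma L1_submod_closed : submod_closed L1_pred.
Proof.
split.
  by apply/asboolP; exists (fun=> 0); [exact: L1_fun0|exact: aeclass0].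
move=> a p q /asboolP[f lf ->] /asboolP[g lg ->]; apply/asboolP.
exists (fun x => a * f x + g x); first exact: L1_fun_lin.
by rewrite aeclassZ aeclassD.
Qed.

HB.instance Definition _ :=
  GRing.isSubmodClosed.Build K _ L1_pred L1_submod_closed.

(* The usual L^1 space of K-valued functions modulo equality mu-a.e. *)
Record L1 := MkL1 {
  L1_val :> aefun mu (K^o : normedModType K); L1_valP : L1_val \in L1_pred }.

HB.instance Definition _ := [isSub for L1_val].
HB.instance Definition _ := [Choice of L1 by <:].
HB.instance Definition _ := [SubChoice_isSubLmodule of L1 by <:].

End spaces.

Section norms.
Context d (T : measurableType d) (R : realType) (k : scalar_kind).
Local Notation K := (scalar_field R k).
Variable mu : {measure set T -> \bar R}.

(* The norm of L^1 and of the Bochner integrable functions. *)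
Definition norm1 (V : normedModType K) (p : aefun mu V) : R :=
  Rintegral mu setT (fun x => rnorm (repr p x)).

Lemma norm1E (V : normedModType K) (F : T -> V) :
  (exists2 h : T -> R, measurable_fun setT h & (fun x => rnorm (F x)) = h %[ae mu]) ->
  norm1 (aeclass mu F) = Rintegral mu setT (fun x => rnorm (F x)).
Proof.
move=> [h mh Fh]; congr fine.
have mh' : measurable_fun setT (fun x => `|h x|) by exact: measurableT_comp.
have Fh' : (fun x => rnorm (F x)) = (fun x => `|h x|) %[ae mu].
  by apply: filterS Fh => x /[apply] <-; rewrite ger0_norm// rnorm_ge0.
have rFh : (fun x => rnorm (repr (aeclass mu F) x)) = (fun x => `|h x|) %[ae mu].
  by apply: filterS2 (repr_aeclass mu F) Fh' => x rF Fx Dx; rewrite rF// Fx.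
rewrite (ge0_integral_ae_measurable _ _ mh' rFh)//; last by move=> x; exact: rnorm_ge0.
by rewrite (ge0_integral_ae_measurable _ _ mh' Fh')// => x; exact: rnorm_ge0.
Qed.

Lemma L1P (u : L1 k mu) :
  exists2 f : T -> K, L1_fun mu f & L1_val u = aeclass mu (f : T -> K^o).
Proof. by have /asboolP := L1_valP u. Qed.

(* A Sigma-measurable representative. *)
Definition L1_repr (u : L1 k mu) : T -> K := sval (cid2 (L1P u)).

Lemma L1_reprP (u : L1 k mu) : L1_fun mu (L1_repr u).
Proof. by rewrite /L1_repr; case: cid2. Qed.

Lemma L1_reprK (u : L1 k mu) : aeclass mu (L1_repr u : T -> K^o) = L1_val u.
Proof. by rewrite /L1_repr; case: cid2. Qed.

End norms.

Section dual.
Context (R : realType) (k : scalar_kind).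
Local Notation K := (scalar_field R k).

Record continuous_dual (X : normedModType K) := Dual {
  dual_fun :> {linear X -> K^o} ;
  dual_continuous : continuous dual_fun }.

End dual.

Section pettis.
Context d (T : measurableType d) (R : realType) (k : scalar_kind).
Local Notation K := (scalar_field R k).
Variable mu : {measure set T -> \bar R}.

Definition scalar_integral (A : set T) (f : T -> K) : K :=
  mk_scalar k (Rintegral mu A (fun x => re_part (f x)))
              (Rintegral mu A (fun x => im_part (f x))).

Variable X : normedModType K.

(* Uniqueness of such an x is the Hahn-Banach theorem. For Bochner integrable G
   this is also the Bochner integral. *)
Definition pettis_integral (A : set T) (G : T -> X) : X :=
  xget 0 [set x | forall xs : continuous_dual X,
    xs x = scalar_integral A (fun t => xs (G t))].

Definition bochner_integral (G : bochner mu X) : X :=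
  pettis_integral setT (repr (bochner_val G)).

Definition locally_bochner_integrable (F : T -> X) : Prop :=
  strongly_measurable mu F /\
  forall B, finite_measure_sets mu B ->
    bochner_integrable mu (fun x => (\1_B x : K) *: F x).

End pettis.

Section vector_measure_integral.
Context d (T : measurableType d) (R : realType) (k : scalar_kind).
Local Notation K := (scalar_field R k).
Variable mu : {measure set T -> \bar R}.

Section scalar_measure_integral.
Variable lam : scalar_measure k mu.

(* I is the continuous linear extension to L^1(|lam|) of
   sum_j a_j 1_(A_j) |-> sum_j a_j lam(A_j), A_j of finite mu-measure; by
   linearity only indicators are needed. *)
Definition is_integral_functional
    (I : {linear L1 k (vector_variation lam) -> K^o}) : Prop :=
  (exists C : R, forall u, rnorm (I u) <= C * norm1 (L1_val u)) /\
  (forall A u, finite_measure_sets mu A ->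
     L1_val u = aeclass (vector_variation lam) (\1_A : T -> K^o) -> I u = lam A).

(* The integral over A of f with respect to lam, for f in L^1(|lam|). *)
Definition scalar_measure_integral (A : set T) (f : T -> K) : K :=
  xget 0 [set y | exists (I : {linear L1 k (vector_variation lam) -> K^o}) u,
    [/\ is_integral_functional I,
        L1_val u = aeclass (vector_variation lam) (fun x => f x * \1_A x : K^o) &
        y = I u]].

End scalar_measure_integral.

Variable X : normedModType K.

Lemma dual_comp_sigma_additive (nu : vector_measure mu X) (xs : continuous_dual X)
    (B : (set T)^nat) :
  (forall n, finite_measure_sets mu (B n)) -> trivIset setT B ->
  finite_measure_sets mu (\bigcup_n B n) ->
  (fun n => \sum_(i < n) xs (nu (B i))) @ \oo --> xs (nu (\bigcup_n B n)).
Proof.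
move=> fB tB fUB.
have -> : (fun n => \sum_(i < n) xs (nu (B i))) =
    (fun n => xs (\sum_(i < n) nu (B i))).
  by apply/funext => n; rewrite linear_sum.
exact: (cvg_comp _ _ (vector_measure_sigma_additive fB tB fUB)
  (@dual_continuous _ _ _ xs _)).
Qed.

Definition dual_comp (nu : vector_measure mu X) (xs : continuous_dual X) :
    scalar_measure k mu :=
  @VectorMeasure _ _ _ _ mu K^o (fun B => xs (nu B))
    (@dual_comp_sigma_additive nu xs).

Variable nu : vector_measure mu X.

Definition is_integral_on (A : set T) (f : T -> K) (x : X) : Prop :=
  forall xs : continuous_dual X, xs x = scalar_measure_integral (dual_comp nu xs) A f.

Definition vector_measure_integrable (f : T -> K) : Prop :=
  [/\ scalar_measurable f,
      forall xs : continuous_dual X, L1_fun (vector_variation (dual_comp nu xs)) f &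
      forall A, measurable A -> exists x, is_integral_on A f x].

Definition vector_measure_integral (A : set T) (f : T -> K) : X :=
  xget 0 [set x | vector_measure_integrable f /\ is_integral_on A f x].

End vector_measure_integral.

(* Main.v *)
Require Import Defs.
From HB Require Import structures.
From mathcomp Require Import all_boot all_order all_algebra complex.
From mathcomp Require Import all_classical all_reals all_analysis.
From mathcomp Require Import measurable_realfun.

Set Implicit Arguments.
Unset Strict Implicit.
Unset Printing Implicit Defensive.
Import Order.TTheory GRing.Theory Num.Theory.
Import numFieldNormedType.Exports.
Local Open Scope classical_set_scope.
Local Open Scope ring_scope.

(** Write |F| for the pointwise norm of F, and nu for the measure with density F.
    Everything follows from the identity |nu|(A) = int_A |F| dmu for measurable A
    ([variation_density]).

    One inequality is the bound ||int_B F|| <= int_B |F|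
    ([variation_le_density]).  For the other, on a set A of finite measure, F is
    close in the mean to a simple function s; splitting A according to the values
    of s, the set function nu is nearly mu(A_i) v_i on each piece A_i, so that the
    sum of the ||nu(A_i)|| is nearly int_A |s|
    ([density_le_variation_finite]).  It extends to all A by monotone
    convergence, because a strongly measurable function vanishes almost everywhere
    outside a countable union of sets of finite measure
    ([sigma_finite_norm]).

    Integrating nonnegative functions with respect to |nu| then amounts to
    integrating them against |F| dmu.  Applied to |g| this gives
    int |g| d|nu| = int |gF| dmu ([integral_rnorm_scale]), which is both the
    equivalence of g in L^1(|nu|) with gF Bochner integrable, and the isometry.

    For the equality of the integrals let x* be a functional.  The scalar measure
    <nu, x*> has density <F, x*>, and the identity above, for scalar valued F,
    computes its variation.  Hence f |-> int f <F, x*> dmu is a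
    continuous functional on L^1(|<nu, x*>|) with the prescribed values on
    indicators, and by density of simple functions it is the only one
    ([integral_functional_exists], [integral_functional_unique]).  So the
    integral of g with respect to nu and the Bochner integral of gF have the same
    image under every x*.

    Two general facts support this.  By the Hahn-Banach theorem every vector has a
    norming functional, which makes weakly defined integrals unique and bounds
    them by the integral of the norm ([dual_separates],
    [has_integral_norm]).  In a Banach space they exist, as limits of integrals of
    simple functions ([has_integral_exists]). *)

(** * The Hahn-Banach theorem *)

Section hahn_banach.
Variables (R : realType) (V : lmodType R) (p : V -> R).
Hypothesis pD : forall u v, p (u + v) <= p u + p v.
Hypothesis pZ : forall (a : R) u, 0 <= a -> p (a *: u) = a * p u.

(** Graphs of linear functionals, below [p] on their domain and equal to [p x] at
    [x].  Single-valuedness is not part of the definition: it follows from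
    domination.  The second clause is required only of a nonempty [G], which
    lets the union of the empty chain qualify in the application of Zorn's lemma. *)
Let dominated (G : set (V * R)) (x : V) := forall z, G z ->
  [/\ z.2 <= p z.1, forall t, G (t *: x, t * p x) &
      forall a w, G w -> G (a *: z.1 + w.1, a * z.2 + w.2)].

Let p0 : p 0 = 0.
Proof. by have := pZ 0 (lexx 0); rewrite scale0r mul0r. Qed.

Let line_dominated x : dominated [set (t *: x, t * p x) | t in setT] x.
Proof.
move=> _ [t _ <-]; split => [/=|s|a _ [s _ <-]].
- have [t0|t0] := leP 0 t; first by rewrite pZ.
  have := pD (t *: x) (- t *: x); rewrite -scalerDl subrr scale0r p0.
  by rewrite (@pZ (- t)) ?mulNr ?subr_ge0// oppr_ge0 ltW.
- by exists s.
- by exists (a * t + s) => //=; rewrite scalerDl mulrDl scalerA mulrA.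
Qed.

Let dominated_bigcup x (C : set (set (V * R))) :
  C `<=` dominated^~ x -> total_on C subset -> dominated (\bigcup_(G in C) G) x.
Proof.
move=> CP Ct z [G CG Gz]; have [zp Gx Gl] := CP _ CG z Gz; split => //.
- by move=> t; exists G.
- move=> a w [H CH Hw]; have [GH|HG] := Ct _ _ CG CH.
    by exists H => //; have [_ _] := CP _ CH z (GH _ Gz); apply.
  by exists G => //; apply: Gl; exact: HG.
Qed.

(** If [(u, r)] and [(u, s)] are in the graph, so is [(0, r - s)], whence
    [r - s <= p 0 = 0]. *)
Let dominated_fun x G u r s : dominated G x -> G (u, r) -> G (u, s) -> r = s.
Proof.
move=> dG.
suff le r' s' : G (u, r') -> G (u, s') -> r' <= s'.
  by move=> Gr Gs; apply/eqP; rewrite eq_le !le.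
move=> Gr Gs; have [_ _ /(_ (-1) _ Gr)/=] := dG _ Gs.
rewrite scaleN1r addNr mulN1r => /dG[/=]; rewrite p0 => le _ _.
by rewrite -subr_ge0 -oppr_le0 opprB addrC.
Qed.

(** The value [c] at [v] must lie above every [r - p (u - v)] and below every
    [p (u + v) - r], for [(u, r)] in the graph; subadditivity of [p] says that
    these bounds are compatible. *)
Let extension x G v : dominated G x -> G !=set0 -> exists c : R,
  dominated [set (z.1 + t *: v, z.2 + t * c) | z in G & t in setT] x.
Proof.
move=> dG G0.
pose A := [set z.2 - p (z.1 - v) | z in G].
have key z w : G z -> G w -> z.2 - p (z.1 - v) <= p (w.1 + v) - w.2.
  move=> Gz Gw; have [_ _ /(_ 1 _ Gw)] := dG _ Gz.
  rewrite scale1r mul1r => /dG[/= h _ _].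
  rewrite lerBlDr addrAC lerBrDr (le_trans h)//.
  by have -> : z.1 + w.1 = (w.1 + v) + (z.1 - v) by rewrite addrACA subrr addr0 addrC.
have [z0 Gz0] := G0.
have supA : has_sup A.
  split; first by exists (z0.2 - p (z0.1 - v)), z0.
  by exists (p (z0.1 + v) - z0.2) => _ [z Gz <-]; exact: key.
pose c := sup A; exists c.
have cl z : G z -> z.2 - c <= p (z.1 - v).
  move=> Gz; rewrite lerBlDr -lerBlDl; apply: ub_le_sup; first by case: supA.
  by exists z.
have cr z : G z -> z.2 + c <= p (z.1 + v).
  move=> Gz; rewrite addrC -lerBrDr; apply: ge_sup; first by case: supA.
  by move=> _ [w Gw <-]; exact: key.
have GZ a z : G z -> G (a *: z.1, a * z.2).
  move=> Gz; have [_ /(_ 0) ]:= dG _ Gz; rewrite scale0r mul0r => G00 /(_ a _ G00).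
  by rewrite /= !addr0.
move=> _ [z Gz [t _ <-]] /=; split.
- have [t0|t0|->] := ltgtP t 0; last by rewrite scale0r mul0r !addr0; have [] := dG _ Gz.
    have nt0 : 0 < - t by rewrite oppr_gt0.
    have := cl _ (GZ (- t)^-1 _ Gz).
    rewrite /= -(ler_pM2l nt0) -(pZ _ (ltW nt0)) scalerBr mulrBr scalerA mulrA.
    by rewrite divff ?gt_eqF// scale1r mul1r mulNr scaleNr !opprK.
  have := cr _ (GZ t^-1 _ Gz).
  rewrite /= -(ler_pM2l t0) -(pZ _ (ltW t0)) scalerDr mulrDr scalerA mulrA.
  by rewrite divff ?gt_eqF// scale1r mul1r.
- move=> s; exists (s *: x, s * p x); first by have [_ + _] := dG _ Gz; apply.
  by exists 0 => //=; rewrite scale0r mul0r !addr0.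
- move=> a _ [w Gw [s _ <-]].
  exists (a *: z.1 + w.1, a * z.2 + w.2); first by have [_ _] := dG _ Gz; apply.
  exists (a * t + s) => //=; congr pair.
    by rewrite scalerDl scalerDr scalerA addrACA.
  by rewrite mulrDl mulrDr mulrA addrACA.
Qed.

Lemma hahn_banach (x : V) : exists f : V -> R,
  [/\ forall a u v, f (a *: u + v) = a * f u + f v, forall u, f u <= p u & f x = p x].
Proof.
have [G [dG maxG]] := @Zorn_bigcup _ (dominated^~ x) (@dominated_bigcup x).
have G0 : G !=set0.
  apply/set0P/eqP => GE; have := maxG _ _ (@line_dominated x); apply.
  by rewrite GE; split => [? []//|/(_ (0 *: x, 0 * p x))]; apply; exists 0.
have tot v : exists r, G (v, r).
  have [c dH] := extension v dG G0; apply: contrapT => Gv.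
  have [z0 Gz0] := G0; have [_ /(_ 0) ] := dG _ Gz0.
  rewrite scale0r mul0r => G00 _.
  apply: (maxG _ _ dH); split.
    move=> z Gz; exists z => //; exists 0 => //.
    by rewrite scale0r mul0r !addr0 -surjective_pairing.
  move=> /(_ (v, c)) h; apply: Gv; exists c; apply: h.
  by exists (0, 0) => //; exists 1 => //=; rewrite scale1r mul1r !add0r.
pose f v := sval (cid (tot v)).
have Gf v : G (v, f v) by rewrite /f; case: cid.
exists f; split => [a u v|u|].
- apply: (dominated_fun dG (Gf _)).
  by have [_ _ /(_ a _ (Gf v))] := dG _ (Gf u).
- by have [] := dG _ (Gf u).
- apply: (dominated_fun dG (Gf _)).
  by have [_ /(_ 1)] := dG _ (Gf x); rewrite scale1r mul1r.
Qed.

End hahn_banach.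

(** * Scalars and norming functionals *)

Section scalars.
Variables (R : realType) (k : scalar_kind).
Local Notation K := (scalar_field R k).
Implicit Types x y : K.

Lemma mk_scalarK x : mk_scalar k (re_part x) (im_part x) = x.
Proof. by case: k x => //= -[]. Qed.

Lemma im_partD x y : im_part (x + y) = im_part x + im_part y.
Proof. by case: k x y => /= [x y|[a b] [c e]//]; rewrite addr0. Qed.

Lemma re_partMD x y : re_part (x * y) = re_part x * re_part y - im_part x * im_part y.
Proof. by case: k x y => /= [x y|[a b] [c e]//]; rewrite mul0r subr0. Qed.

Lemma im_partM x y : im_part (x * y) = re_part x * im_part y + im_part x * re_part y.
Proof. by case: k x y => /= [x y|[a b] [c e]//]; rewrite mul0r mulr0 addr0. Qed.

Lemma mk_scalar0D (a b : R) : mk_scalar k (a + b) 0 = mk_scalar k a 0 + mk_scalar k b 0.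
Proof. by case: k => //=; apply/eqP; rewrite eq_complex /= addr0 !eqxx. Qed.

Lemma mk_scalar0M (a b : R) : mk_scalar k (a * b) 0 = mk_scalar k a 0 * mk_scalar k b 0.
Proof.
case: k => //=; apply/eqP.
by rewrite eq_complex /= !mulr0 mul0r subr0 addr0 !eqxx.
Qed.

Lemma mk_scalar1 : mk_scalar k 1 0 = 1 :> K.
Proof. by case: k. Qed.

(** In the complex case, with [q] the value at [i *: u] of a real functional of
    value [p] at [u], this is the multiplicativity in [x] of its complexification
    [p - i q]. *)
Lemma mk_scalar_comb x (p q r s : R) :
  mk_scalar k (re_part x * p + im_part x * q + r) (- (re_part x * q - im_part x * p + s)) =
  x * mk_scalar k p (- q) + mk_scalar k r (- s).
Proof.
case: k x => /= [x|[a b]]; first by rewrite mul0r addr0.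
by apply/eqP; rewrite eq_complex /= mulrN opprK eqxx /= !opprD opprK mulrN.
Qed.

Lemma ler_re_part x : `|re_part x| <= rnorm (x : K^o).
Proof.
case: k x => //= -[a b].
suff : `|a| <= complex.Re `|(a +i* b)%C| by [].
by rewrite normc_def /= -sqrtr_sqr ler_wsqrtr// lerDl sqr_ge0.
Qed.

Lemma ler_im_part x : `|im_part x| <= rnorm (x : K^o).
Proof.
case: k x => [x|[a b]] /=.
  suff : `|0 : R| <= @rnorm R RealScalars R^o x by [].
  by rewrite normr0 rnorm_ge0.
suff : `|b| <= complex.Re `|(a +i* b)%C| by [].
by rewrite normc_def /= -sqrtr_sqr ler_wsqrtr// lerDr sqr_ge0.
Qed.

Lemma ler_rnorm_parts x : rnorm (x : K^o) <= `|re_part x| + `|im_part x|.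
Proof.
case: k x => [x|[a b]] /=.
  suff : @rnorm R RealScalars R^o x <= `|x : R| + `|0 : R| by [].
  by rewrite normr0 addr0.
suff : complex.Re `|(a +i* b)%C| <= `|a| + `|b| by [].
rewrite normc_def /= -[leRHS]ger0_norm ?addr_ge0// -(sqrtr_sqr (`|a| + `|b|)).
rewrite ler_wsqrtr// (sqrrD `|a| `|b|) !real_normK ?num_real// [leRHS]addrAC lerDl.
by rewrite mulrn_wge0// mulr_ge0.
Qed.

Lemma rnorm_mk_scalar0 (a : R) : 0 <= a -> rnorm (mk_scalar k a 0 : K^o) = a.
Proof.
move=> a0; rewrite /rnorm ger0_norm ?re_mk_scalar//.
by case: k => //=; rewrite lecE /= eqxx.
Qed.

Lemma rnorm_eq0 (V : normedModType K) (v : V) : (rnorm v == 0) = (v == 0).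
Proof.
apply/idP/eqP => [/eqP v0|->]; last by rewrite rnorm0.
by apply/eqP; rewrite -normr_eq0 -(re_partK (normr_ge0 v)) -/(rnorm v) v0; case: k.
Qed.

End scalars.

(** An alias keeps the real scalar multiplication apart from the one by
    [scalar_field R k], of which it is a restriction. *)
Definition realified (R : realType) (k : scalar_kind)
  (V : normedModType (scalar_field R k)) : Type := V.

Section realified.
Variables (R : realType) (k : scalar_kind) (V : normedModType (scalar_field R k)).

Let rscale (a : R) (v : realified V) : realified V := (mk_scalar k a 0 *: (v : V)).

HB.instance Definition _ := GRing.Zmodule.copy (realified V) V.

Let rscaleA a b v : rscale a (rscale b v) = rscale (a * b) v.
Proof. by rewrite /rscale scalerA mk_scalar0M. Qed.

Let rscale1 : left_id 1 rscale.
Proof. by move=> v; rewrite /rscale mk_scalar1 scale1r. Qed.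

Let rscaleDr : right_distributive rscale +%R.
Proof. by move=> a u v; rewrite /rscale scalerDr. Qed.

Let rscaleDl v : {morph rscale^~ v : a b / a + b}.
Proof. by move=> a b; rewrite /rscale mk_scalar0D scalerDl. Qed.

HB.instance Definition _ := GRing.Zmodule_isLmodule.Build R (realified V)
  rscaleA rscale1 rscaleDr rscaleDl.

Lemma realified_scaleE (a : R) (v : V) :
  a *: (v : realified V) = mk_scalar k a 0 *: v :> V.
Proof. by []. Qed.

End realified.

Section dual.
Variables (R : realType) (k : scalar_kind) (V : normedModType (scalar_field R k)).
Local Notation K := (scalar_field R k).

Lemma dual_bounded (xs : continuous_dual V) :
  exists2 C : R, 0 <= C & forall v, rnorm (xs v : K^o) <= C * rnorm v.
Proof.
have /linear_boundedP [M [Mr Mb]] : bounded_near xs (nbhs (0 : V)).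
  by apply/continuous_linear_bounded; exact: dual_continuous.
have C0 : (0 : K) <= `|M| + 1 by rewrite addr_ge0.
exists (re_part (`|M| + 1)); first by rewrite -(re_part0 R k) le_re_part.
move=> v; rewrite /rnorm -re_partM// le_re_part//; apply: Mb.
by rewrite (le_lt_trans (real_ler_norm Mr))// ltrDl.
Qed.

Lemma bounded_dual_continuous (f : {linear V -> K^o}) (C : R) :
  (forall v, rnorm (f v) <= C * rnorm v) -> continuous f.
Proof.
move=> fC v; apply/cvg_rnormB => e e0.
have C0 : 0 < `|C| + 1 by rewrite ltr_wpDl.
have /cvg_rnormB/(_ _ (divr_gt0 e0 C0)) : (id : V -> V) @ v --> v by exact: cvg_id.
apply: filterS => u; rewrite ltr_pdivlMr// mulrC -linearB; apply: le_lt_trans.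
rewrite (le_trans (fC _))// ler_wpM2r ?rnorm_ge0// (le_trans (ler_norm _))//.
by rewrite lerDl.
Qed.

(** The Hahn-Banach theorem for the realified space yields a real functional [f]
    below the norm; its complexification [u |-> f u - i f (i u)] has real part [f].
    When the scalars are real, [mk_scalar k 0 1] is 0 and the same formula gives
    [f] back. *)
Lemma norming_functional (v : V) : exists xs : continuous_dual V,
  (forall u, re_part (xs u) <= rnorm u) /\ re_part (xs v) = rnorm v.
Proof.
have [||f [fl fle fv]] := @hahn_banach R (realified V) (@rnorm R k V) _ _ v.
- exact: ler_rnormD.
- by move=> a u a0; rewrite realified_scaleE rnormZ rnorm_mk_scalar0.
have f0 : f 0 = 0 by have := fl (-1) 0 0; rewrite scaler0 addr0 mulN1r addNr.
have fD u w : f (u + w) = f u + f w.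
  by have := fl 1 u w; rewrite scale1r mul1r.
have fZ a (u : V) : f (mk_scalar k a 0 *: u) = a * f u.
  by have := fl a u 0; rewrite !addr0 f0 addr0.
have fN (u : V) : f (- u) = - f u.
  by apply/eqP; rewrite -addr_eq0 -fD addNr f0.
pose I : K := mk_scalar k 0 1.
pose xs (u : V) : K^o := mk_scalar k (f u) (- f (I *: u)).
have xsl : linear xs.
  move=> a u w; rewrite /xs.
  (* With [I] the imaginary unit, or 0 for real scalars: [a = re a + I im a]. *)
  have aE : a = mk_scalar k (re_part a) 0 + mk_scalar k 0 1 * mk_scalar k (im_part a) 0.
    case: (k) a => /= [a|[b c]]; first by rewrite mulr0 addr0.
    by apply/eqP; rewrite eq_complex /= !mulr0 mul0r mul1r subr0 addr0 !add0r !eqxx.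
  have fa w' : f (a *: w') = re_part a * f w' + im_part a * f (I *: w').
    by rewrite {1}aE scalerDl fD fZ [mk_scalar k 0 1 * _]mulrC -scalerA fZ.
  have fI w' : im_part a * f (I *: (I *: w')) = - (im_part a * f w').
    suff II : mk_scalar k (im_part a) 0 * I * I = - mk_scalar k (im_part a) 0.
      by rewrite -!fZ !scalerA II scaleNr fN.
    rewrite /I; case: (k) a {aE fa} => [a|[b c]] /=; first by rewrite !mulr0 oppr0.
    apply/eqP; rewrite eq_complex /=.
    by rewrite !(mulr0, mul0r, mulr1, subr0, addr0, add0r, oppr0, sub0r) !eqxx.
  rewrite !fD !fa scalerDr fD scalerA [I * a]mulrC -scalerA fa fI.
  exact: mk_scalar_comb.
have xsC u : rnorm (xs u) <= 2 * rnorm u.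
  have fle' w : `|f w| <= rnorm w.
    by rewrite ler_norml fle lerNl -fN (le_trans (fle _))// rnormN.
  have I1 : rnorm (I : K^o) <= 1.
    rewrite (le_trans (ler_rnorm_parts _))// /I.
    by case: (k) => /=; rewrite ?normr0 ?add0r ?normr1.
  rewrite (le_trans (ler_rnorm_parts _))// mulr_natl mulr2n /xs.
  have ir (a b : R) : `|im_part (mk_scalar k a b)| <= `|b|.
    by case: (k) => //=; rewrite normr0.
  rewrite re_mk_scalar lerD// (le_trans (ir _ _))// normrN (le_trans (fle' _))//.
  by rewrite rnormZ ler_piMl ?rnorm_ge0.
pose XS : {linear V -> K^o} := HB.pack xs (GRing.isLinear.Build _ _ _ _ xs xsl).
exists (@Dual _ _ _ XS (@bounded_dual_continuous XS 2 xsC)); split => [u|] /=;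
  rewrite /xs re_mk_scalar//.
Qed.

Lemma dual_separates (u v : V) : (forall xs : continuous_dual V, xs u = xs v) -> u = v.
Proof.
move=> uv; apply/eqP; rewrite -subr_eq0 -rnorm_eq0.
have [xs [_ <-]] := norming_functional (u - v).
by rewrite linearB /= uv subrr re_part0.
Qed.

End dual.

(** * Real integrals of functions equal almost everywhere to measurable ones *)

Section ae_integrals.
Context d (T : measurableType d) (R : realType) (mu : {measure set T -> \bar R}).
Implicit Types f g : T -> R.

Definition ae_measurable f : Prop :=
  exists2 h : T -> R, measurable_fun setT h & f = h %[ae mu].

Lemma measurable_ae f : measurable_fun setT f -> ae_measurable f.
Proof. by exists f => //; exact: aeW. Qed.

Lemma ae_integrable_measurable f : ae_integrable mu f -> ae_measurable f.
Proof. by move=> [h /integrableP[/measurable_EFinP mh _] fh]; exists h. Qed.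

Lemma ae_integrable_eq f g : f = g %[ae mu] -> ae_integrable mu g -> ae_integrable mu f.
Proof. by move=> fg [h ih gh]; exists h => //; exact: ae_eq_trans fg gh. Qed.

(** The integral of a nonmeasurable function is the difference of the suprema over
    simple functions below its positive and negative parts, and each of these
    suprema ignores null sets. *)
Lemma integral_ae_measurable f h : measurable_fun setT h -> f = h %[ae mu] ->
  (\int[mu]_x (f x)%:E = \int[mu]_x (h x)%:E)%E.
Proof.
move=> mh fh; rewrite integralE [RHS]integralE.
have posE (u : T -> R) : ((EFin \o u)^\+)%E = EFin \o (fun x => Num.max (u x) 0).
  by apply/funext => x; rewrite funeposE /= EFin_max.
have negE (u : T -> R) : ((EFin \o u)^\-)%E = EFin \o (fun x => Num.max (- u x) 0).
  by apply/funext => x; rewrite funenegE /= EFin_max.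
rewrite -/(EFin \o f) -/(EFin \o h) !posE !negE; congr (_ - _)%E;
  apply: ge0_integral_ae_measurable.
- by move=> x; rewrite le_max lexx orbT.
- by move=> x; rewrite le_max lexx orbT.
- exact: measurable_maxr.
- exact: (ae_eq_comp (fun r => Num.max r 0)).
- by move=> x; rewrite le_max lexx orbT.
- by move=> x; rewrite le_max lexx orbT.
- by apply: measurable_maxr => //; exact: measurableT_comp.
- exact: (ae_eq_comp (fun r => Num.max (- r) 0)).
Qed.

Lemma eq_ae_integral f g : ae_measurable f -> f = g %[ae mu] ->
  (\int[mu]_x (f x)%:E = \int[mu]_x (g x)%:E)%E.
Proof.
move=> [h mh fh] fg; rewrite (integral_ae_measurable mh fh).
by apply/esym/integral_ae_measurable => //; exact: ae_eq_trans (ae_eq_sym fg) fh.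
Qed.

Lemma eq_ae_Rintegral f g : ae_measurable f -> f = g %[ae mu] ->
  Rintegral mu setT f = Rintegral mu setT g.
Proof. by move=> mf fg; congr fine; exact: eq_ae_integral. Qed.

Lemma ge0_ae_integrableP f : ae_measurable f -> (forall x, 0 <= f x) ->
  ae_integrable mu f <-> (\int[mu]_x (f x)%:E < +oo)%E.
Proof.
move=> [h mh fh] f0.
have mh' : measurable_fun setT (fun x => `|h x|) by exact: measurableT_comp.
have fh' : f = (fun x => `|h x|) %[ae mu].
  by apply: filterS fh => x /[apply] <-; rewrite ger0_norm.
rewrite (integral_ae_measurable mh' fh'); split=> [[l il fl]|hoo].
  have /integrableP[/measurable_EFinP ml loo] := il.
  rewrite (_ : (\int[mu]_x _ = \int[mu]_x `|(l x)%:E|)%E)//.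
  apply: (@integral_ae_measurable _ (fun x => `|l x|)); first exact: measurableT_comp.
  by apply: filterS2 fh' fl => x fhx flx _; rewrite -flx// -fhx// ger0_norm.
exists h => //; apply/integrableP; split => //; exact/measurable_EFinP.
Qed.

Lemma ae_integrable_indic (A : set T) : finite_measure_sets mu A ->
  ae_integrable mu (\1_A : T -> R).
Proof.
move=> [mA Aoo]; apply/ge0_ae_integrableP; last by rewrite integral_indic// setIT.
  exact/measurable_ae/measurable_indic.
by move=> x; rewrite indicE.
Qed.

Lemma ae_integrable_lin (a : R) f g : ae_integrable mu f -> ae_integrable mu g ->
  ae_integrable mu (fun x => a * f x + g x).
Proof. by move=> fi gi; apply: ae_integrableD => //; exact: ae_integrableZ. Qed.

Lemma ae_integrable0 : ae_integrable mu (fun=> 0).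
Proof. by exists (fun=> 0); [exact: integrable0|exact: aeW]. Qed.

Lemma ae_integrable_sum (I : Type) (r : seq I) (F : I -> T -> R) :
  (forall i, ae_integrable mu (F i)) -> ae_integrable mu (fun x => \sum_(i <- r) F i x).
Proof.
move=> Fi; elim: r => [|i r ih].
  by under eq_fun do rewrite big_nil; exact: ae_integrable0.
by under eq_fun do rewrite big_cons; exact: ae_integrableD.
Qed.

Lemma Rintegral_lin (a : R) f g : ae_integrable mu f -> ae_integrable mu g ->
  Rintegral mu setT (fun x => a * f x + g x) =
  a * Rintegral mu setT f + Rintegral mu setT g.
Proof.
move=> [h ih fh] [l il gl].
have iah := @integrableZl _ _ _ mu setT measurableT a _ ih.
rewrite (@eq_ae_Rintegral f h) ?(@eq_ae_Rintegral g l)//; last 2 first.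
- by apply: ae_integrable_measurable; exists l.
- by apply: ae_integrable_measurable; exists h.
rewrite -RintegralZl// -RintegralD//; apply: eq_ae_Rintegral.
  by apply: ae_integrable_measurable; apply: ae_integrable_lin; [exists h|exists l].
by apply: filterS2 fh gl => x fh gl Dx; rewrite fh// gl.
Qed.

Lemma Rintegral0 : Rintegral mu setT (fun=> 0 : R) = 0.
Proof. by rewrite /Rintegral integral0. Qed.

Lemma RintegralDT f g : ae_integrable mu f -> ae_integrable mu g ->
  Rintegral mu setT (fun x => f x + g x) = Rintegral mu setT f + Rintegral mu setT g.
Proof.
move=> fi gi; rewrite -[X in _ = X + _]mul1r -Rintegral_lin//.
by under [in RHS]eq_fun do rewrite mul1r.
Qed.

Lemma RintegralZT (a : R) f : ae_integrable mu f ->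
  Rintegral mu setT (fun x => a * f x) = a * Rintegral mu setT f.
Proof.
move=> fi; have := Rintegral_lin a fi ae_integrable0.
by under eq_fun do rewrite addr0; rewrite Rintegral0 addr0.
Qed.

Lemma Rintegral_sum (I : Type) (r : seq I) (F : I -> T -> R) :
  (forall i, ae_integrable mu (F i)) ->
  Rintegral mu setT (fun x => \sum_(i <- r) F i x) =
  \sum_(i <- r) Rintegral mu setT (F i).
Proof.
move=> Fi; elim: r => [|i r ih].
  by rewrite big_nil; under eq_fun do rewrite big_nil; exact: Rintegral0.
rewrite big_cons -ih -RintegralDT//; last exact: ae_integrable_sum.
by under eq_fun do rewrite big_cons.
Qed.

Lemma le_ae_Rintegral f g : ae_integrable mu f -> ae_integrable mu g ->
  (forall x, f x <= g x) -> Rintegral mu setT f <= Rintegral mu setT g.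
Proof.
move=> fi gi fg; rewrite -subr_ge0 addrC -mulN1r -Rintegral_lin//.
by apply: Rintegral_ge0 => x _; rewrite mulN1r addrC subr_ge0.
Qed.

Lemma Rintegral_EFin f : ae_integrable mu f ->
  (Rintegral mu setT f)%:E = (\int[mu]_x (f x)%:E)%E.
Proof.
move=> fi; have [h ih fh] := fi; rewrite /Rintegral fineK//.
rewrite (integral_ae_measurable _ fh); last by case/integrableP: ih => /measurable_EFinP.
exact: integrable_fin_num.
Qed.

Lemma Rintegral_dominated_cvg0 (u : (T -> R)^nat) g :
  (forall n, ae_measurable (u n)) -> ae_integrable mu g ->
  (forall n x, `|u n x| <= g x) -> {ae mu, forall x, u ^~ x @ \oo --> 0} ->
  (fun n => Rintegral mu setT (u n)) @ \oo --> 0.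
Proof.
move=> mu_ [h ih gh] ug u0.
pose v n := sval (cid2 (mu_ n)).
have mv n : measurable_fun setT (v n) by rewrite /v; case: cid2.
have uv n : u n = v n %[ae mu] by rewrite /v; case: cid2.
have [|||_ _] := @dominated_convergence _ _ _ mu setT measurableT
  (fun n => EFin \o v n) (cst 0%E) (EFin \o h) _ (measurable_cst _) _ ih.
- by move=> n; apply/measurable_EFinP.
- have /ae_foralln : forall n, {ae mu, forall x, u n x = v n x}.
    by move=> n; apply: filterS (uv n) => x; apply.
  apply: filterS2 u0 => x u0 uvx _.
  apply: cvg_EFin; first exact: nearW.
  by under eq_fun do rewrite /= -uvx; exact: u0.
- have /ae_foralln : forall n, {ae mu, forall x, u n x = v n x}.
    by move=> n; apply: filterS (uv n) => x; apply.
  apply: filterS2 gh => x ghx uvx n _ /=.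
  by rewrite lee_fin -uvx -ghx.
rewrite integral0 => /fine_cvg h0.
under eq_fun do rewrite (eq_ae_Rintegral (mu_ _) (uv _)).
exact: h0.
Qed.

End ae_integrals.

(** * Approximation by simple functions *)

Section indicators.
Context (T : Type) (R : realType) (k : scalar_kind).
Local Notation K := (scalar_field R k).
Variables (V : normedModType K) (A : set T).

Lemma indic_scale_in x (v : V) : A x -> (\1_A x : K) *: v = v.
Proof. by move=> Ax; rewrite indicE mem_set// scale1r. Qed.

Lemma indic_scale_out x (v : V) : ~ A x -> (\1_A x : K) *: v = 0.
Proof. by move=> Ax; rewrite indicE memNset// scale0r. Qed.

Lemma rnorm_indic_scale x (v : V) : rnorm ((\1_A x : K) *: v) = \1_A x * rnorm v.
Proof.
have [Ax|Ax] := pselect (A x).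
  by rewrite indic_scale_in// indicE mem_set// mul1r.
by rewrite indic_scale_out// indicE memNset// mul0r rnorm0.
Qed.

Lemma rnorm_indic_scale_le x (v : V) : rnorm ((\1_A x : K) *: v) <= rnorm v.
Proof.
by rewrite rnorm_indic_scale ler_piMl ?rnorm_ge0// indicE lern1 leq_b1.
Qed.

End indicators.

Section finitely_valued.
Context d (T : measurableType d) (R : realType) (k : scalar_kind).
Local Notation K := (scalar_field R k).

Definition finitely_valued (f : T -> K) : Prop :=
  finite_set (range f) /\ forall A : set K, measurable (f @^-1` A).

Lemma finitely_valued_measurable f : finitely_valued f -> scalar_measurable f.
Proof. by move=> [_ mf]; apply/scalar_measurableP => U _. Qed.

Lemma finitely_valued_indic (A : set T) : measurable A -> finitely_valued (\1_A : T -> K).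
Proof.
move=> mA; split.
  apply: (@sub_finite_set _ _ [set 0; 1]) => // _ [x _ <-].
  by rewrite indicE; case: (x \in A); [right|left].
by move=> B; rewrite preimage_indic; case: ifP => _; case: ifP => _ //; exact: measurableC.
Qed.

Lemma finitely_valued_piecewise (A : set T) f (a : K) : measurable A ->
  finitely_valued f -> finitely_valued (fun x => if x \in A then a else f x).
Proof.
move=> mA [ff mf]; split.
  apply: (@sub_finite_set _ _ (a |` range f)); last by rewrite finite_setU; split.
  by move=> _ [x _ <-]; case: ifP => _; [left|right; exists x].
move=> B.
have -> : (fun x => if x \in A then a else f x) @^-1` B =
    (A `&` [set x | B a]) `|` (~` A `&` f @^-1` B).
  apply/seteqP; split=> [x|x] /=; case: ifPn => [/set_mem Ax|/negP Ax].
  - by left.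
  - by right; split => // Ax'; apply: Ax; exact: mem_set.
  - by case=> -[].
  - by case=> -[// Ax']; exfalso; apply: Ax; exact: mem_set.
apply: measurableU; apply: measurableI => //; last exact: measurableC.
have [Ba|Ba] := pselect (B a).
  by rewrite (_ : [set _ | _] = setT)//; apply/seteqP; split.
by rewrite (_ : [set _ | _] = set0)//; apply/seteqP; split.
Qed.

Lemma measurable_ltr_set (f g : T -> R) :
  measurable_fun setT f -> measurable_fun setT g -> measurable [set x | f x < g x].
Proof.
move=> mf mg; have := @measurable_lte _ _ _ setT measurableT (EFin \o f) (EFin \o g).
rewrite setTI; under eq_set do rewrite lte_fin.
by apply; exact/measurable_EFinP.
Qed.

(** At each point the [n]-th approximation is the best one among 0 and the first
    [n] terms of a dense sequence.  Starting at 0 makes the error never larger than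
    the function, which is the domination needed in limit theorems. *)
Lemma scalar_approximation (f : T -> K) : scalar_measurable f ->
  exists s : (T -> K)^nat,
    [/\ forall n, finitely_valued (s n),
        forall n x, rnorm (f x - s n x : K^o) <= rnorm (f x : K^o) &
        forall x, (fun n => rnorm (f x - s n x : K^o)) @ \oo --> 0].
Proof.
move=> mf.
pose closer (u : T -> K) n : set T := [set x |
  rnorm (f x - dense_seq R k n : K^o) < rnorm (f x - u x : K^o)].
pose s := fix s n : T -> K := if n isn't m.+1 then fun=> 0 else
  fun x => if x \in closer (s m) m then dense_seq R k m else s m x.
have mcloser u n : scalar_measurable u -> measurable (closer u n).
  move=> mu.
  have msub v : scalar_measurable v -> measurable_fun setT (fun x => rnorm (f x - v x : K^o)).
    move=> mv; apply: measurable_rnorm; apply: scalar_measurableD => //.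
    rewrite (_ : (fun x => - v x) = (fun x => -1 * v x)); first exact: scalar_measurableZ.
    by apply/funext => x; rewrite mulN1r.
  by apply: measurable_ltr_set; apply: msub => //; exact: scalar_measurable_cst.
have fs n : finitely_valued (s n).
  elim: n => [|n ih] /=.
    split=> [|B]; first by apply: (@sub_finite_set _ _ [set 0]) => // _ [x _ <-].
    by rewrite -[X in measurable X]/(cst 0 @^-1` B) preimage_cst; case: ifP.
  by apply: finitely_valued_piecewise => //; exact/mcloser/finitely_valued_measurable.
have decr x n : rnorm (f x - s n.+1 x : K^o) <= rnorm (f x - s n x : K^o).
  by rewrite /=; case: ifPn => // /set_mem /ltW.
have mono x m n : (m <= n)%N -> rnorm (f x - s n x : K^o) <= rnorm (f x - s m x : K^o).
  elim: n => [|n ih]; first by rewrite leqn0 => /eqP ->.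
  by rewrite leq_eqVlt ltnS => /predU1P[->//|/ih]; apply: le_trans.
exists s; split => // [n x|x].
  by have := mono x 0 n (leq0n _); rewrite /= subr0.
apply/cvgrPdist_lt => e e0; have [m mP] := dense_seqP (f x) e0.
near=> n; rewrite sub0r normrN ger0_norm ?rnorm_ge0//.
apply: (@le_lt_trans _ _ (rnorm (f x - s m.+1 x : K^o))).
  by apply: mono; near: n; exact: nbhs_infty_ge.
rewrite /=; case: ifPn => // /negP mC.
rewrite (le_lt_trans _ mP)// leNgt; apply/negP => h; apply: mC; exact: mem_set.
Unshelve. all: by end_near. Qed.

End finitely_valued.

Section strongly_measurable.
Context d (T : measurableType d) (R : realType) (k : scalar_kind).
Local Notation K := (scalar_field R k).
Variables (mu : {measure set T -> \bar R}) (V : normedModType K).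
Implicit Types F G : T -> V.

(** Off a null set [phi \o G] is a limit of the measurable functions [phi \o s n];
    multiplying by the indicator of the complement makes the limit hold
    everywhere. *)
Lemma strongly_measurable_lipschitz (phi : V -> R) (C : R) G :
  (forall u v, `|phi u - phi v| <= C * rnorm (u - v)) ->
  strongly_measurable mu G -> ae_measurable mu (phi \o G).
Proof.
move=> phiC [s ss [N [mN N0 sN]]].
have sE x : ~ N x -> (fun n => phi (s n x)) @ \oo --> phi (G x).
  move=> Nx; have /cvg_rnormB sG : s ^~ x @ \oo --> G x.
    by apply: contrapT => sG; apply: Nx; exact: sN.
  apply/cvgrPdist_lt => e e0; have C0 : 0 < `|C| + 1 by rewrite ltr_wpDl.
  have := sG _ (divr_gt0 e0 C0); apply: filterS => n; rewrite ltr_pdivlMr// mulrC.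
  apply: le_lt_trans; rewrite (le_trans (phiC _ _))// ler_wpM2r ?rnorm_ge0//.
  by rewrite (le_trans (ler_norm _))// lerDl.
have mCN : measurable (~` N) by exact: measurableC.
exists (fun x => phi (G x) * \1_(~` N) x).
  apply: (@measurable_fun_cvg _ _ _ setT (fun n x => phi (s n x) * \1_(~` N) x)).
    move=> n; apply: measurable_funM; last exact: measurable_indic.
    move=> _ Y mY; rewrite setTI.
    exact: (@simple_fun_preimage _ _ _ _ mu _ _ (phi @^-1` Y)).
  move=> x _; have [Nx|Nx] := pselect (N x).
    have -> : \1_(~` N) x = 0 :> R by rewrite indicE memNset.
    by rewrite mulr0; under eq_fun do rewrite mulr0; exact: cvg_cst.
  have -> : \1_(~` N) x = 1 :> R by rewrite indicE mem_set.
  by rewrite mulr1; under eq_fun do rewrite mulr1; exact: sE.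
exists N; split => // x /=; apply: contra_notP => Nx _.
by rewrite indicE mem_set// mulr1.
Qed.

Lemma ae_measurable_rnorm G : strongly_measurable mu G ->
  ae_measurable mu (fun x => rnorm (G x)).
Proof. exact: strongly_measurable_rnorm. Qed.

Lemma simple_strongly_measurable G : simple_fun mu G -> strongly_measurable mu G.
Proof. by move=> sG; exists (fun=> G) => //; apply: aeW => x; exact: cvg_cst. Qed.

Lemma strongly_measurable_eq F G : F = G %[ae mu] ->
  strongly_measurable mu F -> strongly_measurable mu G.
Proof.
by move=> FG [s ss sF]; exists s => //; apply: filterS2 FG sF => x <-.
Qed.

(** The factor [a] may have a support of infinite measure; only [G] controls the
    support of the product. *)
Lemma simple_fun_scale (a : T -> K) G : finitely_valued a -> simple_fun mu G ->
  simple_fun mu (fun x => a x *: G x).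
Proof.
move=> [fa ma] sG; have [fG mG G0] := sG.
have mH A : measurable ((fun x => a x *: G x) @^-1` A).
  have -> : (fun x => a x *: G x) @^-1` A =
      \bigcup_(p in range a) (a @^-1` [set p] `&` G @^-1` [set v | A (p *: v)]).
    apply/seteqP; split=> [x /= Ax|x [p _ /= [->//]]].
    by exists (a x) => //=; exists x.
  apply: fin_bigcup_measurable => // p _; apply: measurableI => //.
  exact: (simple_fun_preimage _ sG).
split=> [|v|]; last 1 first.
- by apply: (finite_measure_setsS G0) => // x /=; apply: contra_not => ->; rewrite scaler0.
- apply: (@sub_finite_set _ _ [set p *: v | p in range a & v in range G]).
    by move=> _ [x _ <-]; exists (a x) => //; exists (G x).
  exact: finite_image2.
- exact: mH.
Qed.

Lemma strongly_measurable_scale (g : T -> K) F : scalar_measurable g ->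
  strongly_measurable mu F -> strongly_measurable mu (fun x => g x *: F x).
Proof.
move=> /scalar_approximation[a [fa _ ag]] [s ss sF].
exists (fun n x => a n x *: s n x) => [n|]; first exact: simple_fun_scale.
apply: filterS sF => x sx; apply: cvgZ => //.
apply/(@cvg_rnormB _ _ K^o) => e e0.
have /cvgrPdist_lt/(_ _ e0) := ag x; apply: filterS => n.
by rewrite sub0r normrN ger0_norm ?rnorm_ge0.
Qed.

Lemma simple_fun_indic (A : set T) (v : V) : finite_measure_sets mu A ->
  simple_fun mu (fun x => (\1_A x : K) *: v).
Proof.
move=> fA; have [mA _] := fA.
have mB (B : set V) : measurable ((fun x => (\1_A x : K) *: v) @^-1` B).
  have [_ /(_ [set a | B (a *: v)])] := finitely_valued_indic R k mA; exact.
split => [|w|]; first 2 last.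
- apply: (finite_measure_setsS fA) => // x /=; apply: contra_notP.
  exact: indic_scale_out.
- apply: (@sub_finite_set _ _ [set 0; v]) => // _ [x _ <-].
  have [Ax|Ax] := pselect (A x); first by right; rewrite indic_scale_in.
  by left; rewrite indic_scale_out.
- exact: mB.
Qed.

(** Keeping the value 0 in the list makes the sets a partition of the whole
    space, at the price of one of them having possibly infinite measure. *)
Lemma simple_fun_partition G : simple_fun mu G ->
  exists n (v : 'I_n -> V) (A : 'I_n -> set T),
    [/\ forall i, measurable (A i), forall i, v i != 0 -> finite_measure_sets mu (A i),
        trivIset setT A, forall x, exists i, A i x & forall i x, A i x -> G x = v i].
Proof.
move=> [/finite_seqP[r rE] mG G0]; pose q := undup r.
exists (size q), (tnth (in_tuple q)), (fun i => G @^-1` [set tnth (in_tuple q) i]).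
split => // [i vi0|i j _ _ [x [/= -> qij]]|x].
- by apply: (finite_measure_setsS G0) => // x /= ->; exact/eqP.
- apply/val_inj/eqP; move: qij => /eqP.
  by rewrite !(tnth_nth 0) /= nth_uniq ?undup_uniq.
- have : [set` r] (G x) by rewrite -rE; exists x.
  by rewrite /= -mem_undup => /(tnthP (in_tuple q))[i Gi]; exists i.
Qed.

(** The value 0 of [G] is the only one taken on a set of possibly infinite measure;
    that set is replaced by the empty one. *)
Lemma simple_fun_sum G : simple_fun mu G ->
  exists n (v : 'I_n -> V) (B : 'I_n -> set T),
    (forall i, finite_measure_sets mu (B i)) /\
    G = fun x => \sum_(i < n) (\1_(B i) x : K) *: v i.
Proof.
move=> sG; have [n [v [A [mA fA tA cA GA]]]] := simple_fun_partition sG.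
exists n, v, (fun i => if v i == 0 then set0 else A i); split => [i|].
  by case: ifPn => [_|/fA//]; exact: finite_measure_sets0.
apply/funext => x; have [i Ai] := cA x; rewrite (GA _ _ Ai) (bigD1 i)//=.
rewrite big1 ?addr0 => [|j ji].
  by case: eqVneq => [->|vi0]; [rewrite scaler0|rewrite indic_scale_in].
case: eqVneq => [->|vj0]; first by rewrite scaler0.
rewrite indic_scale_out// => Aj; move/eqP : ji; apply.
by apply: tA => //; exists x.
Qed.

End strongly_measurable.

(** * Bochner and Pettis integrals *)

Section scalar_integral.
Context d (T : measurableType d) (R : realType) (k : scalar_kind).
Local Notation K := (scalar_field R k).
Variable mu : {measure set T -> \bar R}.
Implicit Types f g : T -> K.

Definition scalar_integrable f : Prop :=
  ae_integrable mu (fun x => re_part (f x)) /\ ae_integrable mu (fun x => im_part (f x)).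

Lemma re_scalar_integral A f :
  re_part (scalar_integral mu A f) = Rintegral mu A (fun x => re_part (f x)).
Proof. exact: re_mk_scalar. Qed.

Lemma im_scalar_integral f :
  im_part (scalar_integral mu setT f) = Rintegral mu setT (fun x => im_part (f x)).
Proof.
rewrite /scalar_integral; case: (k) f => //= f.
by rewrite -[LHS](Rintegral0 mu).
Qed.

Lemma scalar_integral_lin (a : K) f g : scalar_integrable f -> scalar_integrable g ->
  scalar_integral mu setT (fun x => a * f x + g x) =
  a * scalar_integral mu setT f + scalar_integral mu setT g.
Proof.
move=> [rf jf] [rg jg].
rewrite -[RHS]mk_scalarK re_partD im_partD re_partMD im_partM.
rewrite !re_scalar_integral !im_scalar_integral; congr mk_scalar.
  rewrite addrAC addrC -mulNr -Rintegral_lin// -Rintegral_lin//; last exact: ae_integrable_lin.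
  congr (Rintegral _ _ _); apply/funext => x.
  by rewrite re_partD re_partMD mulNr [RHS]addrC [LHS]addrAC.
rewrite -addrA -Rintegral_lin// -Rintegral_lin//; last exact: ae_integrable_lin.
congr (Rintegral _ _ _); apply/funext => x.
by rewrite im_partD im_partM addrA.
Qed.

Lemma eq_ae_scalar_integral f g : scalar_integrable f -> f = g %[ae mu] ->
  scalar_integral mu setT f = scalar_integral mu setT g.
Proof.
move=> [/ae_integrable_measurable rf /ae_integrable_measurable jf] fg.
by rewrite /scalar_integral; congr mk_scalar; apply: eq_ae_Rintegral => //;
  apply: filterS fg => x /[apply] ->.
Qed.

Lemma scalar_integral_support (A : set T) f : (forall x, ~ A x -> f x = 0) ->
  scalar_integral mu A f = scalar_integral mu setT f.
Proof.
move=> fA; have [re0 im0] : re_part (0 : K) = 0 /\ im_part (0 : K) = 0 by case: (k).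
by rewrite /scalar_integral; congr mk_scalar; rewrite Rintegral_mkcond;
  congr (Rintegral _ _ _); apply/funext => x; rewrite patchE; case: ifPn => //;
  rewrite notin_setE => /fA ->; rewrite ?re0 ?im0.
Qed.

(** The factor 2 comes from adding real and imaginary parts; it could be removed by
    a rotation, but any constant serves to obtain continuity. *)
Lemma rnorm_scalar_integral f (b : T -> R) : scalar_integrable f -> ae_integrable mu b ->
  (forall x, rnorm (f x : K^o) <= b x) ->
  rnorm (scalar_integral mu setT f : K^o) <= 2 * Rintegral mu setT b.
Proof.
move=> [rf jf] bi fb.
have key (u : T -> R) : ae_integrable mu u -> (forall x, `|u x| <= b x) ->
    `|Rintegral mu setT u| <= Rintegral mu setT b.
  move=> ui ub; rewrite ler_norml -mulN1r -RintegralZT//; apply/andP; split.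
    apply: le_ae_Rintegral => // [|x]; first exact: ae_integrableZ.
    by have := ub x; rewrite ler_norml mulN1r => /andP[].
  by apply: le_ae_Rintegral => // x; rewrite (le_trans (ler_norm _)).
rewrite (le_trans (ler_rnorm_parts _))// re_scalar_integral im_scalar_integral.
rewrite mulr_natl mulr2n lerD//; apply: key => // x; rewrite (le_trans _ (fb x))//.
  exact: ler_re_part.
exact: ler_im_part.
Qed.

End scalar_integral.

Section bochner_integral.
Context d (T : measurableType d) (R : realType) (k : scalar_kind).
Local Notation K := (scalar_field R k).
Variable mu : {measure set T -> \bar R}.

Section normed.
Variable V : normedModType K.
Implicit Types F G : T -> V.

Definition norm_integral G : R := Rintegral mu setT (fun x => rnorm (G x)).

Lemma bochner_integrable_eq F G : F = G %[ae mu] -> bochner_integrable mu F ->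
  bochner_integrable mu G.
Proof.
move=> FG [sF iF]; split; first exact: strongly_measurable_eq FG sF.
apply: ae_integrable_eq iF; apply: filterS FG => x /[apply] ->; exact.
Qed.

Lemma bochner_integrableP F : bochner_integrable mu F <->
  strongly_measurable mu F /\ (\int[mu]_x (rnorm (F x))%:E < +oo)%E.
Proof.
by split=> -[sF iF]; split => //; apply/ge0_ae_integrableP => //; try exact: ae_measurable_rnorm;
  move=> x; exact: rnorm_ge0.
Qed.

Lemma bochner_integrable_dominated F (g : T -> R) : strongly_measurable mu F ->
  ae_integrable mu g -> (forall x, rnorm (F x) <= g x) -> bochner_integrable mu F.
Proof.
move=> sF gi Fg; split => //; apply: ae_integrable_le gi _; first exact: ae_measurable_rnorm.
by move=> x; rewrite ger0_norm ?rnorm_ge0.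
Qed.

Lemma bochner_integrableB F G : bochner_integrable mu F -> bochner_integrable mu G ->
  bochner_integrable mu (fun x => F x - G x).
Proof.
move=> iF iG; have := bochner_integrable_lin (-1) iG iF.
by under eq_fun do rewrite scaleN1r addrC.
Qed.

Lemma bochner_integrable_mask F (A : set T) : bochner_integrable mu F -> measurable A ->
  bochner_integrable mu (fun x => (\1_A x : K) *: F x).
Proof.
move=> [sF iF] mA; apply: bochner_integrable_dominated iF _.
  apply: strongly_measurable_scale => //; apply: finitely_valued_measurable.
  exact: finitely_valued_indic.
by move=> x; exact: rnorm_indic_scale_le.
Qed.

Lemma bochner_integrable_simple G : simple_fun mu G -> bochner_integrable mu G.
Proof.
move=> sG; split; first exact: simple_strongly_measurable.
have [fG mG [mG0 G0]] := sG.
have [M MG] : exists M, forall x, rnorm (G x) <= M.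
  have [n [v [A [_ _ _ cA GA]]]] := simple_fun_partition sG.
  exists (\sum_(i < n) rnorm (v i)) => x; have [i Ai] := cA x.
  rewrite (GA _ _ Ai) (bigD1 i)//= lerDl.
  by apply: sumr_ge0 => j _; exact: rnorm_ge0.
set A := G @^-1` [set~ 0] in mG0 G0.
apply: (@ae_integrable_le _ _ _ _ _ (fun x => M * \1_A x)).
- by apply: ae_measurable_rnorm; exact: simple_strongly_measurable.
- by apply: ae_integrableZ; exact: ae_integrable_indic.
- move=> x; rewrite ger0_norm ?rnorm_ge0// indicE.
  have [Gx|Gx] := eqVneq (G x) 0; last by rewrite mem_set ?mulr1//; exact/eqP.
  by rewrite memNset ?mulr0 ?Gx ?rnorm0//= => /(_ Gx).
Qed.

Lemma norm_integralD F G : bochner_integrable mu F -> bochner_integrable mu G ->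
  norm_integral (fun x => F x + G x) <= norm_integral F + norm_integral G.
Proof.
move=> iF iG; rewrite /norm_integral -RintegralDT; [|by case: iF|by case: iG].
have := bochner_integrable_lin 1 iF iG; under eq_fun do rewrite scale1r.
move=> [_ iFG]; apply: le_ae_Rintegral => //; last by move=> x; exact: ler_rnormD.
by apply: ae_integrableD; [case: iF|case: iG].
Qed.

Lemma norm_integralBC F G :
  norm_integral (fun x => F x - G x) = norm_integral (fun x => G x - F x).
Proof.
by congr (Rintegral _ _ _); apply/funext => x; rewrite -rnormN opprB.
Qed.

(** A simple function is kept where its norm is at most twice that of [G], and
    replaced by 0 elsewhere.  Convergence survives (where [G] does not vanish the
    cut is eventually inactive, where [G] vanishes it forces 0) and the error is
    dominated by three times the norm of [G]. *)
Lemma bochner_approximation G : bochner_integrable mu G ->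
  exists2 s : (T -> V)^nat, forall n, simple_fun mu (s n) &
    (fun n => norm_integral (fun x => G x - s n x)) @ \oo --> 0.
Proof.
move=> [sG iG]; have [s ss sGs] := sG; have [h mh Gh] := ae_measurable_rnorm sG.
pose A n := [set x | rnorm (s n x) <= 2 * `|h x|].
have mA n : measurable (A n).
  have mhn : measurable_fun setT (fun x => 2 * `|h x|).
    by apply: measurable_funM => //; exact: measurableT_comp.
  have ms : measurable_fun setT (fun x => rnorm (s n x)).
    move=> _ Y mY; rewrite setTI.
    exact: (simple_fun_preimage (@rnorm R k V @^-1` Y) (ss n)).
  rewrite (_ : A n = ~` [set x | 2 * `|h x| < rnorm (s n x)]).
    by apply: measurableC; exact: measurable_ltr_set.
  by apply/seteqP; split => x; rewrite /A /= leNgt => /negP.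
exists (fun n x => (\1_(A n) x : K) *: s n x) => [n|].
  by apply: simple_fun_scale => //; exact: finitely_valued_indic.
have ih : ae_integrable mu (fun x => 2 * `|h x|).
  apply: ae_integrableZ; apply: ae_integrable_eq iG.
  by apply: filterS Gh => x /[apply] <-; rewrite ger0_norm// rnorm_ge0.
apply: (Rintegral_dominated_cvg0 (g := fun x => rnorm (G x) + 2 * `|h x|)).
- move=> n; apply: ae_measurable_rnorm.
  have := strongly_measurable_lin (-1) (simple_strongly_measurable
    (simple_fun_scale (finitely_valued_indic R k (mA n)) (ss n))) sG.
  by under eq_fun do rewrite scaleN1r addrC.
- exact: ae_integrableD.
- move=> n x; rewrite ger0_norm ?rnorm_ge0//.
  rewrite (le_trans (ler_rnormD _ _))// lerD2l rnormN.
  have [Ax|Ax] := pselect (A n x); first by rewrite indic_scale_in.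
  by rewrite indic_scale_out// rnorm0 mulr_ge0.
- apply: filterS2 Gh sGs => x /(_ I) Gh sx.
  have [Gx|Gx] := eqVneq (G x) 0.
    rewrite (_ : (fun n => _) = fun=> 0); first exact: cvg_cst.
    apply/funext => n; rewrite Gx sub0r rnormN.
    have [Ax|Ax] := pselect (A n x); last by rewrite indic_scale_out// rnorm0.
    rewrite indic_scale_in//; apply/eqP; rewrite eq_le rnorm_ge0 andbT.
    by move: Ax; rewrite /A /= -Gh Gx rnorm0 normr0 mulr0.
  move/cvg_rnormB : sx => sx.
  have G0 : 0 < rnorm (G x) by rewrite lt_neqAle rnorm_ge0 eq_sym rnorm_eq0 Gx.
  apply/cvgrPdist_lt => e e0.
  apply: filterS2 (sx _ e0) (sx _ G0) => n se sG'.
  rewrite sub0r normrN ger0_norm ?rnorm_ge0//.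
  rewrite indic_scale_in// /A /= -Gh ger0_norm ?rnorm_ge0//.
  rewrite -[s n x](subrK (G x)) (le_trans (ler_rnormD _ _))//.
  by rewrite mulr_natl mulr2n lerD2r -rnormN opprB ltW.
Qed.

Lemma dual_scalar_integrable (xs : continuous_dual V) G :
  bochner_integrable mu G -> scalar_integrable mu (fun x => xs (G x)).
Proof.
move=> [sG iG]; have [C C0 xsC] := dual_bounded xs.
have re_lip (x y : K) : re_part x - re_part y = re_part (x - y).
  by case: (k) x y => //= -[? ?] [].
have im_lip (x y : K) : im_part x - im_part y = im_part (x - y).
  by case: (k) x y => [x y|[? ?] []] //=; rewrite subrr.
split; apply: ae_integrable_le (ae_integrableZ C iG) _.
- apply: (@strongly_measurable_lipschitz _ _ _ _ _ _ (fun v => re_part (xs v)) C) => // u v.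
  by rewrite re_lip -linearB (le_trans (ler_re_part _))// xsC.
- by move=> x; rewrite (le_trans (ler_re_part _))// xsC.
- apply: (@strongly_measurable_lipschitz _ _ _ _ _ _ (fun v => im_part (xs v)) C) => // u v.
  by rewrite im_lip -linearB (le_trans (ler_im_part _))// xsC.
- by move=> x; rewrite (le_trans (ler_im_part _))// xsC.
Qed.

(** The relational form of the integral: [pettis_integral] has a default value
    where no integral exists, and this predicate records existence. *)
Definition has_integral G (v : V) : Prop := bochner_integrable mu G /\
  forall xs : continuous_dual V, xs v = scalar_integral mu setT (fun x => xs (G x)).

Lemma has_integral_unique G u v : has_integral G u -> has_integral G v -> u = v.
Proof.
by move=> [_ Gu] [_ Gv]; apply: dual_separates => xs; rewrite Gu Gv.
Qed.

Lemma has_integral_eq F G v : F = G %[ae mu] -> has_integral F v -> has_integral G v.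
Proof.
move=> FG [iF Fv]; split => [|xs]; first exact: bochner_integrable_eq FG iF.
rewrite Fv; apply: eq_ae_scalar_integral; first exact: dual_scalar_integrable.
by apply: filterS FG => x /[apply] ->.
Qed.

Lemma pettis_integralE G v : has_integral G v -> pettis_integral mu setT G = v.
Proof.
move=> Gv; apply: (@has_integral_unique G) => //; split; first by case: Gv.
rewrite /pettis_integral.
have : exists v, forall xs : continuous_dual V,
  xs v = scalar_integral mu setT (fun t => xs (G t)) by exists v; case: Gv.
by move=> /(@xgetPex _ 0).
Qed.

Lemma has_integral0 : has_integral (fun=> 0) 0.
Proof.
split=> [|xs]; first exact: bochner_integrable0.
rewrite -[LHS]mk_scalarK /scalar_integral linear0.
have [-> ->] : re_part (0 : K) = 0 /\ im_part (0 : K) = 0 by case: (k).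
by rewrite !Rintegral0.
Qed.

Lemma has_integral_lin (a : K) F G u v : has_integral F u -> has_integral G v ->
  has_integral (fun x => a *: F x + G x) (a *: u + v).
Proof.
move=> [iF Fu] [iG Gv]; split => [|xs]; first exact: bochner_integrable_lin.
rewrite linearP Fu Gv -scalar_integral_lin; [|exact: dual_scalar_integrable..].
by congr (scalar_integral _ _ _); apply/funext => x; rewrite linearP.
Qed.

Lemma has_integral_sum (I : Type) (r : seq I) (F : I -> T -> V) (v : I -> V) :
  (forall i, has_integral (F i) (v i)) ->
  has_integral (fun x => \sum_(i <- r) F i x) (\sum_(i <- r) v i).
Proof.
move=> Fv; elim: r => [|i r ih].
  by under eq_fun do rewrite big_nil; rewrite big_nil; exact: has_integral0.
under eq_fun do rewrite big_cons; rewrite big_cons -[v i]scale1r.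
have := has_integral_lin 1 (Fv i) ih.
by under eq_fun do rewrite scale1r.
Qed.

Lemma has_integral_indic (A : set T) v : finite_measure_sets mu A ->
  has_integral (fun x => (\1_A x : K) *: v) (mk_scalar k (fine (mu A)) 0 *: v).
Proof.
move=> fA; have [mA Aoo] := fA; split.
  by apply: bochner_integrable_simple; exact: simple_fun_indic.
move=> xs; rewrite linearZ /= -[LHS]mk_scalarK /scalar_integral.
have iA := ae_integrable_indic fA.
have A1 : Rintegral mu setT (\1_A : T -> R) = fine (mu A).
  by rewrite /Rintegral integral_indic// setIT.
have E (x : T) : xs ((\1_A x : K) *: v) = mk_scalar k (\1_A x) 0 * xs v.
  rewrite linearZ /=; congr (_ * _); rewrite !indicE.
  by case: (x \in A) => /=; rewrite ?mk_scalar1//; case: (k).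
have rE (a : R) (x : K) : re_part (mk_scalar k a 0 * x) = re_part x * a.
  by case: (k) x => [x|[p q]] /=; rewrite ?mul0r ?subr0 mulrC.
have iE (a : R) (x : K) : im_part (mk_scalar k a 0 * x) = im_part x * a.
  by case: (k) x => [x|[p q]] /=; rewrite ?mul0r ?addr0// mulrC.
rewrite rE iE -A1 -!RintegralZT//; congr mk_scalar;
  congr (Rintegral _ _ _); apply/funext => x.
  by rewrite E rE.
by rewrite E iE.
Qed.

Lemma has_integral_simple G : simple_fun mu G -> exists v, has_integral G v.
Proof.
move=> /simple_fun_sum[n [v [B [fB ->]]]].
exists (\sum_(i < n) mk_scalar k (fine (mu (B i))) 0 *: v i).
by apply: has_integral_sum => i; exact: has_integral_indic.
Qed.

(** A functional whose real part is dominated by the norm, with equality at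
    [v], reduces the estimate to monotonicity of a real integral. *)
Lemma has_integral_norm G v : has_integral G v -> rnorm v <= norm_integral G.
Proof.
move=> [iG Gv]; have [xs [xs1 <-]] := norming_functional v.
rewrite Gv re_scalar_integral; apply: le_ae_Rintegral.
- by have [] := dual_scalar_integrable xs iG.
- by case: iG.
- by move=> x; exact: xs1.
Qed.

End normed.

(** The integrals of simple functions that approximate [G] in the mean form a Cauchy
    sequence, since the norm of an integral is at most the integral of the norm. *)
Lemma has_integral_exists (X : completeNormedModType K) (G : T -> X) :
  bochner_integrable mu G -> exists v, has_integral G v.
Proof.
move=> iG; have [s ss sG] := bochner_approximation iG.
pose x n := sval (cid (has_integral_simple (ss n))).
have xP n : has_integral (s n) (x n) by rewrite /x; case: cid.
have is_ n : bochner_integrable mu (s n) by case: (xP n).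
have xD m n : rnorm (x m - x n) <=
    norm_integral (fun t => G t - s m t) + norm_integral (fun t => G t - s n t).
  have := has_integral_lin (-1) (xP n) (xP m); rewrite scaleN1r addrC => /has_integral_norm.
  move=> /le_trans; apply.
  rewrite [X in _ <= X + _]norm_integralBC.
  have := norm_integralD (bochner_integrableB (is_ m) iG) (bochner_integrableB iG (is_ n)).
  apply: le_trans; rewrite le_eqVlt; apply/orP; left; apply/eqP.
  congr (Rintegral _ _ _); apply/funext => t.
  by rewrite scaleN1r addrA subrK addrC.
have cx : cvgn x.
  apply/cauchy_cvgP/cauchy_exP => e e0.
  have re0 : 0 < re_part e by rewrite -(re_part0 R k) lt_re_part.
  have /cvgrPdist_lt/(_ _ (divr_gt0 re0 (ltr0Sn R 1)))[N _ NP] := sG.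
  have {}NP n : (N <= n)%N -> norm_integral (fun t => G t - s n t) < re_part e / 2.
    by move=> /NP; rewrite /= sub0r normrN => /(le_lt_trans (ler_norm _)).
  exists (x N), N => // n Nn; rewrite -ball_normE /= rnorm_lt//.
  rewrite (le_lt_trans (xD _ _))// [ltRHS]splitr ltrD//; exact: NP.
pose v : X := limn x; have {}cx : x @ \oo --> v := cx.
exists v; split => // xs.
have [C C0 xsC] := dual_bounded xs.
have key n : rnorm (xs (x n) - scalar_integral mu setT (fun t => xs (G t)) : K^o) <=
    2 * (C * norm_integral (fun t => G t - s n t)).
  have [_ ->] := xP n.
  have := scalar_integral_lin (-1) (dual_scalar_integrable xs iG)
    (dual_scalar_integrable xs (is_ n)).
  rewrite mulN1r [X in _ = X]addrC => <-.
  rewrite /norm_integral -RintegralZT; last by have [] := bochner_integrableB iG (is_ n).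
  apply: rnorm_scalar_integral.
  - have := dual_scalar_integrable xs (bochner_integrable_lin (-1) iG (is_ n)).
    by under eq_fun do rewrite linearP.
  - by apply: ae_integrableZ; have [] := bochner_integrableB iG (is_ n).
  - move=> t; rewrite mulN1r addrC -linearB -(rnormN (G t - _)) opprB; exact: xsC.
apply: (cvg_unique (@norm_hausdorff _ K^o) (F := (fun n => xs (x n) : K^o) @ \oo)).
  by apply: cvg_comp cx _; exact: dual_continuous.
apply/cvg_rnormB => e e0.
have D0 : 0 < 2 * (C + 1) by rewrite mulr_gt0// ltr_wpDl.
have /cvgrPdist_lt/(_ _ (divr_gt0 e0 D0)) := sG; apply: filterS => n.
rewrite sub0r normrN ltr_pdivlMr// => h; rewrite -rnormN opprB.
apply: le_lt_trans h; rewrite (le_trans (key n))//.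
rewrite ger0_norm; last by apply: Rintegral_ge0 => ? _; exact: rnorm_ge0.
rewrite mulrA [leRHS]mulrC ler_wpM2r//; last by rewrite ler_wpM2l// lerDl.
by apply: Rintegral_ge0 => ? _; exact: rnorm_ge0.
Qed.

End bochner_integral.

(** * The variation of a measure with density *)

Section measure_with_density.
Context d (T : measurableType d) (R : realType).
Variables (mu nu : {measure set T -> \bar R}) (h : T -> R).
Hypothesis mh : measurable_fun setT h.
Hypothesis h0 : forall x, 0 <= h x.
Hypothesis nuE : forall A, measurable A -> nu A = (\int[mu]_x (\1_A x * h x)%:E)%E.

Import HBNNSimple.

Let mprod (f : T -> R) : measurable_fun setT f ->
  measurable_fun setT (fun x => (f x * h x)%:E).
Proof. by move=> mf; apply/measurable_EFinP; exact: measurable_funM. Qed.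

Let integral_nnsfun_density (f : {nnsfun T >-> R}) :
  (\int[nu]_x (f x)%:E = \int[mu]_x (f x * h x)%:E)%E.
Proof.
have fE x : f x = \sum_(y \in range f) (y * \1_(f @^-1` [set y]) x) by exact: fimfunE.
transitivity (\int[nu]_x (\sum_(y \in range f) (y * \1_(f @^-1` [set y]) x)%:E))%E.
  by apply: eq_integral => x _; rewrite [in LHS]fE -fsumEFin.
transitivity (\int[mu]_x (\sum_(y \in range f) (y * \1_(f @^-1` [set y]) x * h x)%:E))%E;
    last first.
  apply: eq_integral => x _; rewrite fsumEFin//; congr _%:E.
  by rewrite [in RHS]fE mulr_fsuml.
have mi y : measurable_fun setT (fun x => y * \1_(f @^-1` [set y]) x).
  by apply: measurable_funM => //; exact: measurable_indic.
rewrite !ge0_integral_fsum//.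
- apply: eq_fsbigr => y /[!inE] -[t _ <-].
  rewrite integralZl_indic_nnsfun// integral_indic// setIT nuE//.
  rewrite -ge0_integralZl ?lee_fin//=.
  + by apply: eq_integral => x _; rewrite -EFinM mulrA.
  + by apply: mprod; exact: measurable_indic.
  + by move=> x _; rewrite lee_fin mulr_ge0// indicE.
- by move=> y; exact: mprod.
- move=> y x _; rewrite EFinM mule_ge0 ?lee_fin//.
  by have := nnfun_muleindic_ge0 f y x; rewrite lee_fin.
- by move=> y; exact/measurable_EFinP.
- by move=> y x _; exact: nnfun_muleindic_ge0.
Qed.

(** The hypothesis on [nu] is the case of indicators; linearity gives nonnegative
    simple functions and monotone convergence all nonnegative measurable ones. *)
Lemma ge0_integral_density (f : T -> R) : measurable_fun setT f -> (forall x, 0 <= f x) ->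
  (\int[nu]_x (f x)%:E = \int[mu]_x (f x * h x)%:E)%E.
Proof.
move=> mf f0.
have mf' : measurable_fun setT (EFin \o f) by exact/measurable_EFinP.
have f0' x : setT x -> (0 <= (EFin \o f) x)%E by rewrite lee_fin.
pose s := nnsfun_approx measurableT mf'.
have sf x : (fun n => (s n x)%:E) @ \oo --> (f x)%:E.
  exact: (cvg_nnsfun_approx measurableT mf' f0').
have nds x m n : (m <= n)%N -> s m x <= s n x by move=> mn; exact/lefP/nd_nnsfun_approx.
have lhs : (fun n => \int[nu]_x (s n x)%:E)%E @ \oo --> (\int[nu]_x (f x)%:E)%E.
  have -> : (\int[nu]_x (f x)%:E = \int[nu]_x limn (fun n => (s n x)%:E))%E.
    by apply: eq_integral => x _; apply/esym/cvg_lim => //; exact: sf.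
  apply: cvg_monotone_convergence => //.
  - by move=> n; exact/measurable_EFinP.
  - by move=> n x _; rewrite lee_fin.
  - by move=> x _ m n mn; rewrite lee_fin nds.
have rhs : (fun n => \int[nu]_x (s n x)%:E)%E @ \oo --> (\int[mu]_x (f x * h x)%:E)%E.
  under eq_fun do rewrite integral_nnsfun_density.
  have -> : (\int[mu]_x (f x * h x)%:E = \int[mu]_x limn (fun n => (s n x * h x)%:E))%E.
    apply: eq_integral => x _; apply/esym/cvg_lim => //.
    under eq_fun do rewrite EFinM.
    by rewrite EFinM; apply: cvgeZr => //; exact: sf.
  apply: cvg_monotone_convergence => //.
  - by move=> n; exact: mprod.
  - by move=> n x _; rewrite lee_fin mulr_ge0.
  - by move=> x _ m n mn; rewrite lee_fin ler_wpM2r// nds.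
exact: (cvg_unique _ lhs rhs).
Qed.

End measure_with_density.

Section disjoint_indicators.
Context (T : Type) (R : realType) (n : nat) (B : 'I_n -> set T).
Hypothesis tB : trivIset setT B.

Lemma sum_disjoint_indic i x : B i x -> \sum_(j < n) (\1_(B j) x : R) = 1.
Proof.
move=> Bi; rewrite (bigD1 i)//= indicE mem_set// big1 ?addr0// => j ji.
rewrite indicE memNset// => Bj; move/eqP : ji; apply.
by apply: tB => //; exists x.
Qed.

Lemma sum_disjoint_indic_le (A : set T) x : (forall i, B i `<=` A) ->
  \sum_(j < n) (\1_(B j) x : R) <= \1_A x.
Proof.
move=> BA; have [[i Bi]|nB] := pselect (exists i, B i x).
  by rewrite (sum_disjoint_indic Bi) indicE mem_set//; exact: BA Bi.
rewrite big1 ?indicE// => i _; rewrite indicE memNset// => Bi.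
by apply: nB; exists i.
Qed.

End disjoint_indicators.

Section variation_density.
Context d (T : measurableType d) (R : realType) (k : scalar_kind).
Local Notation K := (scalar_field R k).
Variables (mu : {measure set T -> \bar R}) (V : normedModType K).
Implicit Types F G : T -> V.

(** The function is almost everywhere a limit of simple functions, hence vanishes
    where they all do; [S n] is the union of the first [n] supports.  The
    measurable version [h] of the norm is cut off so as to vanish everywhere, and
    not only almost everywhere, outside of the [S n]. *)
Lemma sigma_finite_norm F : strongly_measurable mu F ->
  exists (h : T -> R) (S : (set T)^nat),
    [/\ measurable_fun setT h, forall x, 0 <= h x, (fun x => rnorm (F x)) = h %[ae mu],
        (forall n, finite_measure_sets mu (S n)) /\ nondecreasing_seq S &
        forall x, (forall n, ~ S n x) -> h x = 0].
Proof.
move=> sF; have [h mh Fh] := ae_measurable_rnorm sF.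
have [s ss sFx] := sF.
pose S n := \big[setU/set0]_(i < n) (s i @^-1` [set~ 0]).
have fS n : finite_measure_sets mu (S n).
  rewrite /S; elim: n => [|n [ms ihoo]].
    by rewrite big_ord0; exact: finite_measure_sets0.
  have [_ _ [mn noo]] := ss n; rewrite big_ord_recr /=; split; first exact: measurableU.
  by rewrite (le_lt_trans (measureU2 _ _ _))// lte_add_pinfty.
have mS : measurable (\bigcup_n S n) by apply: bigcup_measurable => n _; case: (fS n).
exists (fun x => `|h x| * \1_(\bigcup_n S n) x), S; split.
- by apply: measurable_funM; [exact: measurableT_comp|exact: measurable_indic].
- by move=> x; rewrite mulr_ge0// indicE.
- apply: filterS2 Fh sFx => x Fhx sx Dx.
  rewrite -Fhx// ger0_norm ?rnorm_ge0//.
  have [Sx|Sx] := pselect ((\bigcup_n S n) x); first by rewrite indicE mem_set// mulr1.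
  rewrite indicE memNset// mulr0.
  suff -> : F x = 0 by rewrite rnorm0.
  have s0 n : s n x = 0.
    apply: contrapT => sn0; apply: Sx; exists n.+1 => //.
    by rewrite /S big_ord_recr /=; right.
  have cv : (fun=> 0 : V) @ \oo --> F x by move: sx; under eq_fun do rewrite s0.
  exact: (cvg_unique (@norm_hausdorff _ V) cv (cvg_cst _)).
- split => // m n mn; apply/subsetPset => x.
  rewrite /S -!(bigcup_mkord _ (fun i => s i @^-1` [set~ 0])) => -[i /= im sx]; exists i => //=.
  exact: leq_trans im mn.
- by move=> x Sx; rewrite indicE memNset ?mulr0// => -[n _ /Sx].
Qed.

Variable nu : vector_measure mu V.

(** Weak integrals are used so that the notion passes to images by functionals. *)
Definition has_density F : Prop := strongly_measurable mu F /\
  forall B, finite_measure_sets mu B ->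
    has_integral mu (fun x => (\1_B x : K) *: F x) (nu B).

Variables (F : T -> V) (h : T -> R).
Hypothesis nuF : has_density F.
Hypothesis mh : measurable_fun setT h.
Hypothesis h0 : forall x, 0 <= h x.
Hypothesis Fh : (fun x => rnorm (F x)) = h %[ae mu].

Let norm_maskE (A : set T) : finite_measure_sets mu A ->
  (norm_integral mu (fun x => (\1_A x : K) *: F x))%:E = (\int[mu]_x (\1_A x * h x)%:E)%E.
Proof.
move=> fA; have [[_ iA] _] := nuF.2 _ fA.
rewrite Rintegral_EFin//; apply: integral_ae_measurable.
  by apply: measurable_funM => //; apply: measurable_indic; case: fA.
by apply: filterS Fh => x Fhx Dx; rewrite rnorm_indic_scale Fhx.
Qed.

Lemma variation_le_density (A : set T) : measurable A ->
  (vector_variation nu A <= \int[mu]_x (\1_A x * h x)%:E)%E.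
Proof.
move=> mA; apply: ge_ereal_sup => _ [n [B [fB tB ->]]].
have m1 (C : set T) : measurable C -> measurable_fun setT (fun x => (\1_C x * h x)%:E).
  by move=> mC; apply/measurable_EFinP; apply: measurable_funM => //; exact: measurable_indic.
apply: (@le_trans _ _ (\sum_(i < n) \int[mu]_x (\1_(B i) x * h x)%:E)%E).
  apply: lee_sum => i _; have [fBi _] := fB i; rewrite -norm_maskE// lee_fin.
  by apply: has_integral_norm; exact: nuF.2.
rewrite -ge0_integral_sum//; last 2 first.
- by move=> i; apply: m1; have [[]] := fB i.
- by move=> i x _; rewrite lee_fin mulr_ge0// indicE.
apply: ge0_le_integral => //.
- by move=> x _; apply: sume_ge0 => i _; rewrite lee_fin mulr_ge0// indicE.
- by apply: emeasurable_sum => i; apply: m1; have [[]] := fB i.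
- exact: m1.
- move=> x _; rewrite sumEFin lee_fin -mulr_suml ler_wpM2r//.
  by apply: sum_disjoint_indic_le => // i; have [] := fB i.
Qed.

(** Let [s] be a simple function close in the mean to [G], the restriction of [F] to
    [A], and let [B i] be the part of [A] where [s] takes the value [v i].  There
    the integral of the norm of [s] is the norm of its integral, so the integral of
    the norm of [G] exceeds the norm of [nu (B i)] by at most twice the integral
    over [B i] of the norm of [G - s].  Summing over [i] bounds the integral over
    [A] by the variation, up to twice the distance from [G] to [s]. *)
Lemma density_le_variation_finite (A : set T) : finite_measure_sets mu A ->
  (\int[mu]_x (\1_A x * h x)%:E <= vector_variation nu A)%E.
Proof.
move=> fA; have [iG _] := nuF.2 _ fA; have [mA _] := fA.
rewrite -norm_maskE//; set G := fun x => _ in iG *.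
have [s ss sG] := bochner_approximation iG.
have key m : ((norm_integral mu G)%:E <= vector_variation nu A +
    (2 * norm_integral mu (fun x => G x - s m x))%:E)%E.
  have [n [v [C [mC _ tC cC sC]]]] := simple_fun_partition (ss m).
  pose B i := A `&` C i.
  have fB i : finite_measure_sets mu (B i).
    by apply: (finite_measure_setsS fA) => [|x []//]; exact: measurableI.
  have tB : trivIset setT B by exact: trivIset_setIl.
  have iB i := bochner_integrable_mask iG (fB i).1.
  have is_ : bochner_integrable mu (s m) by exact: bochner_integrable_simple.
  have iD := bochner_integrableB iG is_.
  have iDB i := bochner_integrable_mask iD (fB i).1.
  have nuB i : has_integral mu (fun x => (\1_(B i) x : K) *: G x) (nu (B i)).
    rewrite (_ : (fun x => _) = fun x => (\1_(B i) x : K) *: F x); first exact: nuF.2.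
    apply/funext => x; rewrite /G; have [Bx|Bx] := pselect (B i x).
      by rewrite !indic_scale_in//; case: Bx.
    by rewrite !(indic_scale_out (A := B i)).
  have hv i := has_integral_indic (v i) (fB i).
  pose D i := norm_integral mu (fun x => (\1_(B i) x : K) *: (G x - s m x)).
  have maskE i x : (\1_(B i) x : K) *: (G x - s m x) =
      (\1_(B i) x : K) *: G x - (\1_(B i) x : K) *: v i.
    have [[Ax Cx]|Bx] := pselect (B i x); last by rewrite !indic_scale_out// subr0.
    by rewrite !indic_scale_in// (sC _ _ Cx).
  have step i : norm_integral mu (fun x => (\1_(B i) x : K) *: G x) <=
      rnorm (nu (B i)) + 2 * D i.
    have hn : rnorm (mk_scalar k (fine (mu (B i))) 0 *: v i) =
        norm_integral mu (fun x => (\1_(B i) x : K) *: v i).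
      rewrite rnormZ rnorm_mk_scalar0 ?fine_ge0// /norm_integral.
      under [in RHS]eq_fun do rewrite rnorm_indic_scale mulrC.
      rewrite RintegralZT; last exact: ae_integrable_indic.
      rewrite mulrC; congr (_ * _).
      by rewrite /Rintegral integral_indic ?setIT//; case: (fB i).
    (* [v i] is compared with [G] twice: inside the norm of the integral, and inside
       the integral of the norm. *)
    have le1 := has_integral_norm (has_integral_lin (-1) (nuB i) (hv i)).
    have le2 := norm_integralD (iDB i) (hv i).1.
    have E1 : norm_integral mu (fun x => (\1_(B i) x : K) *: (G x - s m x) +
        (\1_(B i) x : K) *: v i) = norm_integral mu (fun x => (\1_(B i) x : K) *: G x).
      by congr (Rintegral _ _ _); apply/funext => x; rewrite maskE subrK.
    have E2 : norm_integral mu (fun x => -1 *: ((\1_(B i) x : K) *: G x) +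
        (\1_(B i) x : K) *: v i) = D i.
      by congr (Rintegral _ _ _); apply/funext => x;
        rewrite maskE scaleN1r -rnormN opprD opprK.
    rewrite E2 in le1; rewrite E1 -hn in le2.
    rewrite (le_trans le2)// mulr_natl mulr2n addrCA lerD2l.
    rewrite -lerBlDl (le_trans _ le1)// lerBlDl scaleN1r.
    by rewrite -{1}[X in rnorm X](addNKr (nu (B i))) (le_trans (ler_rnormD _ _))//.
  have sumG : norm_integral mu G =
      \sum_(i < n) norm_integral mu (fun x => (\1_(B i) x : K) *: G x).
    rewrite -Rintegral_sum; last by move=> i; case: (iB i).
    congr (Rintegral _ _ _); apply/funext => x.
    under eq_bigr do rewrite rnorm_indic_scale.
    rewrite -mulr_suml; have [i Ci] := cC x.
    have [Ax|Ax] := pselect (A x); last by rewrite /G indic_scale_out// rnorm0 mulr0.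
    by rewrite (sum_disjoint_indic _ tB (i := i)) ?mul1r.
  have sumD : \sum_(i < n) D i <= norm_integral mu (fun x => G x - s m x).
    rewrite -Rintegral_sum; last by move=> i; case: (iDB i).
    apply: le_ae_Rintegral; last 1 first.
    - move=> x; under eq_bigr do rewrite rnorm_indic_scale.
      rewrite -mulr_suml ler_piMl ?rnorm_ge0//.
      have BA i : B i `<=` A by move=> y [].
      by rewrite (le_trans (sum_disjoint_indic_le R tB x BA)).
    - by apply: ae_integrable_sum => i; case: (iDB i).
    - by case: iD.
  apply: (@le_trans _ _ ((\sum_(i < n) rnorm (nu (B i)))%:E +
      (2 * norm_integral mu (fun x => G x - s m x))%:E)%E).
    rewrite -EFinD lee_fin sumG (le_trans (ler_sum _ (fun i _ => step i)))//.
    by rewrite big_split /= lerD2l -mulr_sumr ler_wpM2l.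
  rewrite leeD2r// -sumEFin; apply: ereal_sup_ubound; exists n, B; split => // i.
  by split => // x [].
have [->|voo] := eqVneq (vector_variation nu A) +oo%E; first exact: leey.
have vfin : vector_variation nu A \is a fin_num.
  by rewrite ge0_fin_numE ?variation_ge0// ltey.
rewrite -(fineK vfin) lee_fin; apply/ler_addgt0Pr => e e0.
have /cvgrPdist_lt/(_ _ (divr_gt0 e0 (ltr0Sn R 1)))[m _ /(_ m (leqnn m))] := sG.
rewrite /= sub0r normrN => /(le_lt_trans (ler_norm _)) sm.
have := key m; rewrite -(fineK vfin) -EFinD lee_fin => /le_trans; apply.
by rewrite lerD2l mulrC -ler_pdivlMr// ltW.
Qed.

End variation_density.

Section variation_eq_density.
Context d (T : measurableType d) (R : realType) (k : scalar_kind).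
Local Notation K := (scalar_field R k).
Variables (mu : {measure set T -> \bar R}) (V : normedModType K).
Variables (nu : vector_measure mu V) (F : T -> V) (h : T -> R) (S : (set T)^nat).
Hypothesis nuF : has_density nu F.
Hypothesis mh : measurable_fun setT h.
Hypothesis h0 : forall x, 0 <= h x.
Hypothesis Fh : (fun x => rnorm (F x)) = h %[ae mu].
Hypothesis fS : forall n, finite_measure_sets mu (S n).
Hypothesis ndS : nondecreasing_seq S.
Hypothesis Sh : forall x, (forall n, ~ S n x) -> h x = 0.

Lemma variation_density (A : set T) : measurable A ->
  vector_variation nu A = (\int[mu]_x (\1_A x * h x)%:E)%E.
Proof.
move=> mA; apply/eqP; rewrite eq_le (variation_le_density nuF)//=.
have fAS n : finite_measure_sets mu (A `&` S n).
  by apply: (finite_measure_setsS (fS n)) => [|x []//]; apply: measurableI => //; case: (fS n).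
have SS x m n : (m <= n)%N -> S m x -> S n x by move=> /ndS/subsetPset; apply.
have cvh : (fun n => \int[mu]_x (\1_(A `&` S n) x * h x)%:E)%E @ \oo -->
    (\int[mu]_x (\1_A x * h x)%:E)%E.
  have -> : (\int[mu]_x (\1_A x * h x)%:E =
      \int[mu]_x limn (fun n => (\1_(A `&` S n) x * h x)%:E))%E.
    apply: eq_integral => x _; apply/esym/cvg_lim => //.
    have [[N SN]|nS] := pselect (exists n, S n x); last first.
      rewrite Sh ?mulr0; last by move=> n Sn; apply: nS; exists n.
      by under eq_fun do rewrite mulr0; exact: cvg_cst.
    apply: cvg_near_cst; near=> n.
    have Sn : S n x by apply: SS SN; near: n; exact: nbhs_infty_ge.
    congr (_ * _)%:E; rewrite !indicE; congr (_%:R); congr nat_of_bool.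
    by rewrite in_setI (mem_set Sn) andbT.
  apply: cvg_monotone_convergence => //.
  - move=> n; apply/measurable_EFinP; apply: measurable_funM => //.
    by apply: measurable_indic; case: (fAS n).
  - by move=> n x _; rewrite lee_fin mulr_ge0// indicE.
  - move=> x _ m n mn; rewrite lee_fin ler_wpM2r//.
    rewrite !indicE ler_nat; case: (boolP (x \in A `&` S m)) => // /set_mem[Ax Sx].
    by rewrite mem_set//; split => //; exact: SS Sx.
rewrite -(cvg_lim _ cvh)//; apply: lime_le; first by apply/cvg_ex; eexists; exact: cvh.
apply: nearW => n.
rewrite (le_trans (density_le_variation_finite nuF mh Fh (fAS n)))//.
exact: (Defs.le_variation nu (@subIsetl _ A (S n))).
Unshelve. all: by end_near. Qed.

Lemma integral_variation (f : T -> R) : measurable_fun setT f -> (forall x, 0 <= f x) ->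
  (\int[vector_variation nu]_x (f x)%:E = \int[mu]_x (f x * h x)%:E)%E.
Proof. exact: (ge0_integral_density mh h0 variation_density). Qed.

End variation_eq_density.

(** * Integration with respect to a scalar measure with density *)

Section density_multiplication.
Context d (T : measurableType d) (R : realType) (k : scalar_kind).
Local Notation K := (scalar_field R k).
Variables (mu : {measure set T -> \bar R}) (V : normedModType K).
Variables (nu : vector_measure mu V) (F : T -> V).
Hypothesis nuF : has_density nu F.

(** The norm of the product is the product of the norms, and the norm of [F] is the
    density of the variation. *)
Lemma integral_rnorm_scale (g : T -> K) : scalar_measurable g ->
  (\int[mu]_x (rnorm (g x *: F x))%:E =
   \int[vector_variation nu]_x (rnorm (g x : K^o))%:E)%E.
Proof.
move=> mg; have [h [S [mh h0 Fh [fS ndS] Sh]]] := sigma_finite_norm nuF.1.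
rewrite (integral_variation nuF mh h0 Fh fS ndS Sh (measurable_rnorm mg)); last first.
  by move=> x; exact: rnorm_ge0.
apply: integral_ae_measurable; first by apply: measurable_funM => //; exact: measurable_rnorm.
by apply: filterS Fh => x Fhx Dx; rewrite rnormZ Fhx.
Qed.

Lemma L1_fun_bochner (g : T -> K) : scalar_measurable g ->
  L1_fun (vector_variation nu) g <-> bochner_integrable mu (fun x => g x *: F x).
Proof.
move=> mg; rewrite bochner_integrableP integral_rnorm_scale//.
by split=> -[_ goo]; split => //; exact: strongly_measurable_scale nuF.1.
Qed.

Lemma norm_integral_scale (g : T -> K) : scalar_measurable g ->
  norm_integral mu (fun x => g x *: F x) =
  Rintegral (vector_variation nu) setT (fun x => rnorm (g x : K^o)).
Proof. by move=> mg; rewrite /norm_integral /Rintegral integral_rnorm_scale. Qed.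

(** On a set that is null for the variation, the norm of [F] has integral 0, so [F]
    vanishes almost everywhere: changing the factor there changes nothing. *)
Lemma eq_ae_scale (f g : T -> K) : f = g %[ae vector_variation nu] ->
  (fun x => f x *: F x) = (fun x => g x *: F x) %[ae mu].
Proof.
have [h [S [mh h0 Fh [fS ndS] Sh]]] := sigma_finite_norm nuF.1.
move=> [N [mN N0 fgN]].
have mNh : measurable_fun setT (fun x => (\1_N x * h x)%:E).
  by apply/measurable_EFinP; apply: measurable_funM => //; exact: measurable_indic.
have /(ae_eq_integral_abs mu measurableT mNh) Nh0 :
    (\int[mu]_x `|(\1_N x * h x)%:E| = 0)%E.
  have <- : vector_variation nu N = 0%E by exact: N0.
  rewrite (variation_density nuF mh h0 Fh fS ndS Sh mN).
  by apply: eq_integral => x _; rewrite gee0_abs// lee_fin mulr_ge0// indicE.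
apply: filterS2 Fh Nh0 => x Fhx /(_ I)[Nhx] _.
have [Nx|Nx] := pselect (N x); last first.
  by congr (_ *: _); apply: contrapT => fg; apply: Nx; apply: fgN => /(_ I).
suff -> : F x = 0 by rewrite !scaler0.
apply/eqP; rewrite -rnorm_eq0 Fhx//; move: Nhx.
by rewrite indicE mem_set// mul1r => ->.
Qed.

End density_multiplication.

Section scalar_mask.
Context d (T : measurableType d) (R : realType) (k : scalar_kind).
Local Notation K := (scalar_field R k).

Lemma scalar_measurable_mask (f : T -> K) (A : set T) : scalar_measurable f ->
  measurable A -> scalar_measurable (fun x => f x * \1_A x).
Proof.
move=> /scalar_measurableP mf mA; apply/scalar_measurableP => U oU.
have -> : (fun x => f x * \1_A x) @^-1` U =
    (A `&` f @^-1` U) `|` (~` A `&` [set x | U 0]).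
  apply/seteqP; split=> x /=; rewrite indicE.
    have [Ax|Ax] := pselect (A x).
      by rewrite mem_set// mulr1; left.
    by rewrite memNset// mulr0; right.
  by case=> -[Ax]; [rewrite mem_set// mulr1|rewrite memNset// mulr0].
apply: measurableU; apply: measurableI => //; [exact: mf|exact: measurableC|].
have [U0|U0] := pselect (U 0).
  by rewrite (_ : [set _ | _] = setT)//; apply/seteqP; split.
by rewrite (_ : [set _ | _] = set0)//; apply/seteqP; split.
Qed.

Variable m : {measure set T -> \bar R}.

Lemma L1_fun_mask (f : T -> K) (A : set T) : L1_fun m f -> measurable A ->
  L1_fun m (fun x => f x * \1_A x).
Proof.
move=> [mf foo] mA; have mfA := scalar_measurable_mask mf mA; split => //.
apply: le_lt_trans foo; apply: ge0_le_integral => //.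
- by move=> x _; rewrite lee_fin rnorm_ge0.
- by apply/measurable_EFinP; exact: measurable_rnorm.
- by apply/measurable_EFinP; exact: measurable_rnorm.
- move=> x _; rewrite lee_fin mulrC; exact: (rnorm_indic_scale_le (V := K^o)).
Qed.

Lemma L1_class (f : T -> K) : L1_fun m f ->
  exists u : L1 k m, L1_val u = aeclass m (f : T -> K^o).
Proof.
move=> lf; have fP : aeclass m (f : T -> K^o) \in @L1_pred _ _ _ k m by apply/asboolP; exists f.
by exists (MkL1 fP).
Qed.

Lemma L1_repr_ae (u : L1 k m) (f : T -> K) : L1_val u = aeclass m (f : T -> K^o) ->
  L1_repr u = f %[ae m].
Proof. by rewrite -L1_reprK => /aeclassP. Qed.

Lemma L1_repr_lin (a : K) (u v : L1 k m) :
  L1_repr (a *: u + v) = (fun x => a * L1_repr u x + L1_repr v x) %[ae m].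
Proof.
apply: L1_repr_ae.
have -> : L1_val (a *: u + v) = a *: L1_val u + L1_val v by [].
by rewrite -(L1_reprK u) -(L1_reprK v) aeclassZ aeclassD.
Qed.

Lemma norm1_class (f : T -> K) : scalar_measurable f ->
  norm1 (aeclass m (f : T -> K^o)) = Rintegral m setT (fun x => rnorm (f x : K^o)).
Proof.
move=> mf; apply: norm1E; exists (fun x => rnorm (f x : K^o)); last exact: aeW.
exact: measurable_rnorm.
Qed.

Lemma norm1_repr (u : L1 k m) :
  norm1 (L1_val u) = Rintegral m setT (fun x => rnorm (L1_repr u x : K^o)).
Proof. by rewrite -L1_reprK norm1_class//; case: (L1_reprP u). Qed.

End scalar_mask.

Lemma aeclass_sum d (T : measurableType d) (R : realType) (m : {measure set T -> \bar R})
    (K : pzRingType) (V : lmodType K) (I : Type) (r : seq I) (f : I -> T -> V) :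
  aeclass m (fun x => \sum_(i <- r) f i x) = \sum_(i <- r) aeclass m (f i).
Proof.
elim: r => [|i r ih].
  by rewrite big_nil; under eq_fun do rewrite big_nil; exact/esym/aeclass0.
by rewrite big_cons -ih aeclassD; under eq_fun do rewrite big_cons.
Qed.

Section scalar_measure.
Context d (T : measurableType d) (R : realType) (k : scalar_kind).
Local Notation K := (scalar_field R k).
Variable mu : {measure set T -> \bar R}.
Variables (lam : scalar_measure k mu) (phi : T -> K^o).
Hypothesis lamphi : has_density lam phi.
Local Notation L := (L1 k (vector_variation lam)).

Lemma has_integral_scalar (G : T -> K^o) (v : K^o) : has_integral mu G v ->
  v = scalar_integral mu setT G.
Proof.
move=> [_]; pose i : {linear K^o -> K^o} := idfun.
have ci : continuous i by move=> x; exact: cvg_id.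
by move=> /(_ (Dual ci)).
Qed.

Let scalar_integrable_scale (f : T -> K) : L1_fun (vector_variation lam) f ->
  bochner_integrable mu (fun x => f x *: phi x) ->
  scalar_integrable mu (fun x => f x * phi x).
Proof.
move=> lf bf; pose i : {linear K^o -> K^o} := idfun.
have ci : continuous i by move=> x; exact: cvg_id.
exact: (dual_scalar_integrable (Dual ci) bf).
Qed.

Let bochner_scale (f : T -> K) : L1_fun (vector_variation lam) f ->
  bochner_integrable mu (fun x => f x *: phi x).
Proof. by move=> lf; apply/(L1_fun_bochner lamphi) => //; case: lf. Qed.

Let I (u : L) : K^o := scalar_integral mu setT (fun x => L1_repr u x * phi x).

Let IE (u : L) (f : T -> K) : L1_val u = aeclass (vector_variation lam) (f : T -> K^o) ->
  I u = scalar_integral mu setT (fun x => f x * phi x).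
Proof.
move=> /L1_repr_ae uf; apply: eq_ae_scalar_integral.
  by apply: scalar_integrable_scale; [|apply: bochner_scale]; exact: L1_reprP.
exact: (eq_ae_scale lamphi uf).
Qed.

Let I_linear : linear I.
Proof.
move=> a u v; rewrite /I.
have iu (w : L) : scalar_integrable mu (fun x => L1_repr w x * phi x).
  by apply: scalar_integrable_scale; [|apply: bochner_scale]; exact: L1_reprP.
rewrite (eq_ae_scalar_integral (iu _) (eq_ae_scale lamphi (L1_repr_lin a u v))).
rewrite -scalar_integral_lin//; congr (scalar_integral _ _ _).
by apply/funext => x; rewrite mulrA -mulrDl.
Qed.

(** Continuity uses the variation formula for [lam]: the integral of the modulus of
    [f * phi] is the norm of [f] in the L^1 space of the variation. *)
Lemma integral_functional_exists : exists J : {linear L -> K^o},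
  is_integral_functional J /\ forall u f,
    L1_val u = aeclass (vector_variation lam) (f : T -> K^o) ->
    J u = scalar_integral mu setT (fun x => f x * phi x).
Proof.
pose J : {linear L -> K^o} := HB.pack I (GRing.isLinear.Build _ _ _ _ I I_linear).
exists J; split; last exact: IE.
split=> [|A u fA uA].
  exists 2 => u; have lu := L1_reprP u; have bu := bochner_scale lu.
  rewrite -[J u]/(I u) norm1_repr -(norm_integral_scale lamphi); last by case: lu.
  by apply: rnorm_scalar_integral => //; [exact: scalar_integrable_scale|case: bu].
rewrite -[J u]/(I u) (IE uA); apply/esym/has_integral_scalar; exact: lamphi.2.
Qed.

Let L1_fun_indic (B : set T) : finite_measure_sets mu B ->
  L1_fun (vector_variation lam) (\1_B : T -> K).
Proof.
move=> fB; apply/(L1_fun_bochner lamphi); last by case: (lamphi.2 _ fB).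
by apply: finitely_valued_measurable; apply: finitely_valued_indic; case: fB.
Qed.

Section uniqueness.
Variables I1 I2 : {linear L -> K^o}.
Hypothesis I1P : is_integral_functional I1.
Hypothesis I2P : is_integral_functional I2.

Let functional_simple (s : T -> K^o) : simple_fun mu s -> exists u : L,
  L1_val u = aeclass (vector_variation lam) s /\ I1 u = I2 u.
Proof.
move=> /simple_fun_sum[n [v [B [fB ->]]]].
pose w i := sval (cid (L1_class (L1_fun_indic (fB i)))).
have wE i : L1_val (w i) = aeclass (vector_variation lam) (\1_(B i) : T -> K^o).
  by rewrite /w; case: cid.
exists (\sum_(i < n) v i *: w i); split.
  rewrite aeclass_sum (big_morph (@L1_val _ _ _ _ _) (id1 := 0) (op1 := +%R))//.
  apply: eq_bigr => i _; rewrite -[L1_val _]/(v i *: L1_val (w i)) wE aeclassZ.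
  by congr aeclass; apply/funext => x; exact: mulrC.
rewrite !linear_sum; apply: eq_bigr => i _; rewrite !linearZ /=; congr (_ *: _).
by rewrite (I1P.2 _ _ (fB i) (wE i)) (I2P.2 _ _ (fB i) (wE i)).
Qed.

(** Simple functions supported by sets of finite [mu]-measure are dense: a simple
    approximation [a n] of a representative is cut down to [S n], where the [S n]
    increase to a set that carries the variation of [lam]. *)
Lemma integral_functional_unique u : I1 u = I2 u.
Proof.
have [h [S [mh h0 phih [fS ndS] Sh]]] := sigma_finite_norm lamphi.1.
have [mf foo] := L1_reprP u; set f := L1_repr u in mf foo.
have [a [fa af afc]] := scalar_approximation mf.
pose s n x : K^o := a n x *: (\1_(S n) x *: (1 : K^o)).
have ss n : simple_fun mu (s n).
  by apply: simple_fun_scale => //; exact: simple_fun_indic.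
pose w n := sval (cid (functional_simple (ss n))).
have wE n : L1_val (w n) = aeclass (vector_variation lam) (s n).
  by rewrite /w; case: cid => ? [].
have Iw n : I1 (w n) = I2 (w n) by rewrite /w; case: cid => ? [].
have ms n : scalar_measurable (s n).
  by apply/scalar_measurableP => U _; exact: (simple_fun_preimage U (ss n)).
have mfs n : scalar_measurable (fun x => f x - s n x).
  rewrite (_ : (fun x => _) = (fun x => -1 * s n x) \+ f).
    by apply: scalar_measurableD => //; exact: scalar_measurableZ.
  by apply/funext => x /=; rewrite mulN1r addrC.
have nE n : norm1 (L1_val (u - w n)) =
    Rintegral (vector_variation lam) setT (fun x => rnorm (f x - s n x : K^o)).
  have -> : L1_val (u - w n) = L1_val u - L1_val (w n) by [].
  rewrite wE -(L1_reprK u) -scaleN1r addrC aeclassZ aeclassD -norm1_class//.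
  by congr (norm1 (aeclass _ _)); apply/funext => x; rewrite scaleN1r addrC.
have cv : (fun n => norm1 (L1_val (u - w n))) @ \oo --> 0.
  under eq_fun do rewrite nE.
  apply: (@Rintegral_dominated_cvg0 _ _ _ _ _ (fun x => rnorm (f x : K^o))).
  - by move=> n; apply: measurable_ae; exact: measurable_rnorm.
  - exists (fun x => rnorm (f x : K^o)); last exact: aeW.
    by have := L1_reprP u; rewrite (L1_fun_integrable _ mf).
  - move=> n x; rewrite ger0_norm ?rnorm_ge0// /s.
    have [Sx|Sx] := pselect (S n x); last by rewrite indic_scale_out// scaler0 subr0.
    by rewrite indic_scale_in// -[_ *: _]/(_ * _) mulr1.
  - have mS : measurable (\bigcup_n S n) by apply: bigcup_measurable => n _; case: (fS n).
    exists (~` \bigcup_n S n); split.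
    + exact: measurableC.
    + have /(variation_density lamphi mh h0 phih fS ndS Sh) E := measurableC mS.
      rewrite [LHS]E integral0_eq// => x _; have [Sx|Sx] := pselect ((\bigcup_n S n) x).
        by rewrite indicE memNset ?mul0r// => /(_ Sx).
      by rewrite Sh ?mulr0// => n Sn; apply: Sx; exists n.
    + move=> x /=; apply: contra_not => -[N _ SN].
      have := afc x; apply: cvg_trans; apply: near_eq_cvg; near=> n.
      have Sn : S n x.
        have /subsetPset : (S N <= S n)%O by apply: ndS; near: n; exact: nbhs_infty_ge.
        exact.
      by rewrite /s indic_scale_in// -[_ *: 1]/(_ * 1) mulr1.
have [[C1 C1P] _] := I1P; have [[C2 C2P] _] := I2P.
apply/eqP; rewrite -subr_eq0 -rnorm_eq0 eq_le rnorm_ge0 andbT.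
have bound n : rnorm (I1 u - I2 u) <= (C1 + C2) * norm1 (L1_val (u - w n)).
  have -> : I1 u - I2 u = I1 (u - w n) - I2 (u - w n).
    by rewrite (linearB I1) (linearB I2) Iw opprB addrA subrK.
  by rewrite (le_trans (ler_rnormD _ _))// rnormN mulrDl lerD.
have cv0 : (fun n => (C1 + C2) * norm1 (L1_val (u - w n))) @ \oo --> 0.
  by rewrite -[X in _ --> X](mulr0 (C1 + C2)); apply: cvgMr.
rewrite -(cvg_lim (@Rhausdorff R) cv0); apply: limr_ge; first by apply/cvg_ex; exists 0.
exact: nearW.
Unshelve. all: by end_near. Qed.

End uniqueness.

Lemma scalar_measure_integralE (A : set T) (f : T -> K) : measurable A ->
  L1_fun (vector_variation lam) f ->
  scalar_measure_integral lam A f = scalar_integral mu setT (fun x => f x * \1_A x * phi x).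
Proof.
move=> mA lf; have [J [JP JE]] := integral_functional_exists.
have [u uE] := L1_class (L1_fun_mask lf mA).
rewrite /scalar_measure_integral; set P := [set y | _].
have : exists y, P y by exists (J u); exists J, u.
move=> /(@xgetPex _ 0)[J' [u' [J'P u'E ->]]].
by rewrite (integral_functional_unique J'P JP) (JE _ _ u'E).
Qed.

End scalar_measure.

(** * Multiplication by the density *)

Section dual_image.
Context d (T : measurableType d) (R : realType) (k : scalar_kind).
Local Notation K := (scalar_field R k).
Variables (mu : {measure set T -> \bar R}) (V : normedModType K).
Implicit Types (F G : T -> V) (xs : continuous_dual V).

Lemma strongly_measurable_dual xs G : strongly_measurable mu G ->
  strongly_measurable mu (fun x => xs (G x) : K^o).
Proof.
move=> [s ss sG]; exists (fun n x => xs (s n x)) => [n|]; last first.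
  by apply: filterS sG => x sx; apply: cvg_comp sx _; exact: dual_continuous.
have mB (B : set K^o) : measurable ((fun x => xs (s n x)) @^-1` B).
  exact: (simple_fun_preimage (xs @^-1` B) (ss n)).
have [fs _ s0] := ss n; split.
- apply: (@sub_finite_set _ _ (xs @` range (s n))); last exact: finite_image.
  by move=> _ [x _ <-]; exists (s n x) => //; exists x.
- by move=> v; exact: mB.
- by apply: (finite_measure_setsS s0) => // x /=; apply: contra_not => ->; rewrite linear0.
Qed.

Lemma has_integral_dual xs G v : has_integral mu G v ->
  has_integral mu (fun x => xs (G x) : K^o) (xs v).
Proof.
move=> [iG Gv]; have [C C0 xsC] := dual_bounded xs; split.
  apply: (bochner_integrable_dominated (g := fun x => C * rnorm (G x))) => //.
    by apply: strongly_measurable_dual; case: iG.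
  by apply: ae_integrableZ; case: iG.
move=> ys; pose f (w : V) : K^o := ys (xs w).
have lf : linear f by move=> a u w; rewrite /f !linearP.
pose zs : {linear V -> K^o} := HB.pack f (GRing.isLinear.Build _ _ _ _ f lf).
have cz : continuous zs.
  move=> w; apply: (@continuous_comp _ _ _ xs ys); exact: dual_continuous.
exact: (Gv (Dual cz)).
Qed.

(** Functionals commute with weak integrals; thus the scalar measures that define
    integration with respect to [nu] fall under the scalar theory. *)
Lemma has_density_dual (nu : vector_measure mu V) F xs : has_density nu F ->
  has_density (dual_comp nu xs) (fun x => xs (F x) : K^o).
Proof.
move=> [sF nuF]; split=> [|B fB]; first exact: strongly_measurable_dual.
have := has_integral_dual xs (nuF B fB).
by under eq_fun do rewrite linearZ.
Qed.

Lemma pettis_integral_support (A : set T) G : (forall x, ~ A x -> G x = 0) ->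
  pettis_integral mu A G = pettis_integral mu setT G.
Proof.
move=> GA; rewrite /pettis_integral; congr xget; apply/seteqP.
by split=> v /= Gv xs; rewrite Gv scalar_integral_support// => x /GA ->; rewrite linear0.
Qed.

Lemma has_density_L1_dual (nu : vector_measure mu V) F xs (g : T -> K) :
  has_density nu F -> L1_fun (vector_variation nu) g ->
  L1_fun (vector_variation (dual_comp nu xs)) g.
Proof.
move=> nuF lg; have [mg _] := lg; have /(L1_fun_bochner nuF mg)[sgF igF] := lg.
apply/(L1_fun_bochner (has_density_dual xs nuF) mg).
have [C C0 xsC] := dual_bounded xs.
apply: (bochner_integrable_dominated (g := fun x => C * rnorm (g x *: F x))).
- by apply: strongly_measurable_scale => //; exact: strongly_measurable_dual nuF.1.
- exact: ae_integrableZ.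
- by move=> x; rewrite -linearZ.
Qed.

(** Both sides take the value of the integral of [1_A g xs(F)] at [xs]: the left by
    hypothesis, the right because [dual_comp nu xs] has density [xs \o F]. *)
Lemma is_integral_on_density (nu : vector_measure mu V) F (g : T -> K) (A : set T) v :
  has_density nu F -> L1_fun (vector_variation nu) g -> measurable A ->
  has_integral mu (fun x => (\1_A x : K) *: (g x *: F x)) v -> is_integral_on nu A g v.
Proof.
move=> nuF lg mA [_ gv] xs; rewrite gv.
rewrite (scalar_measure_integralE (has_density_dual xs nuF) mA).
  by congr (scalar_integral _ _ _); apply/funext => x; rewrite scalerA linearZ /= [_ * g x]mulrC.
exact: has_density_L1_dual nuF lg.
Qed.

End dual_image.

Section banach.
Context d (T : measurableType d) (R : realType) (k : scalar_kind).
Local Notation K := (scalar_field R k).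
Variables (mu : {measure set T -> \bar R}) (X : completeNormedModType K).
Variables (F : T -> X) (nu : vector_measure mu X).

Lemma has_density_pettis : locally_bochner_integrable mu F ->
  (forall B, finite_measure_sets mu B ->
     nu B = pettis_integral mu B (fun t => (\1_B t : K) *: F t)) ->
  has_density nu F.
Proof.
move=> [sF iF] nuE; split => // B fB; have [v Bv] := has_integral_exists (iF B fB).
rewrite (nuE B fB) pettis_integral_support ?(pettis_integralE Bv)// => x.
exact: indic_scale_out.
Qed.

Hypothesis nuF : has_density nu F.

Lemma vector_measure_integralE (g : T -> K) (v : X) : L1_fun (vector_variation nu) g ->
  has_integral mu (fun x => g x *: F x) v -> vector_measure_integral nu setT g = v.
Proof.
move=> lg gv; have [mg _] := lg; have [ig _] := gv.
have on_T : is_integral_on nu setT g v.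
  apply: (is_integral_on_density nuF) => //.
  rewrite (_ : (fun x => _) = fun x => g x *: F x)//.
  by apply/funext => x; rewrite indic_scale_in.
have gnu : vector_measure_integrable nu g.
  split => // [xs|A mA]; first exact: has_density_L1_dual nuF lg.
  have [w Aw] := has_integral_exists (bochner_integrable_mask ig mA).
  by exists w; exact: is_integral_on_density Aw.
rewrite /vector_measure_integral; set P := [set x | _].
have [_ Pv] : P (xget 0 P) by apply: (@xgetPex _ 0); exists v.
by apply: dual_separates => xs; rewrite Pv on_T.
Qed.

Let multiplication_proof (u : L1 k (vector_variation nu)) :
  aeclass mu (fun x => L1_repr u x *: F x) \in @bochner_pred _ _ _ _ mu X.
Proof.
apply/asboolP; exists (fun x => L1_repr u x *: F x) => //.
by apply/(L1_fun_bochner nuF); have [] := L1_reprP u.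
Qed.

Let multiplication (u : L1 k (vector_variation nu)) : bochner mu X :=
  Bochner (multiplication_proof u).

Let multiplication_linear : linear multiplication.
Proof.
move=> a u v; apply: val_inj.
have -> : val (a *: multiplication u + multiplication v) =
  a *: aeclass mu (fun x => L1_repr u x *: F x) + aeclass mu (fun x => L1_repr v x *: F x) by [].
rewrite aeclassZ aeclassD; apply/aeclassP.
apply: ae_eq_trans (eq_ae_scale nuF (L1_repr_lin a u v)) _.
by apply: aeW => x _; rewrite scalerDl scalerA.
Qed.

Lemma multiplication_exists :
  exists M : {linear L1 k (vector_variation nu) -> bochner mu X},
    forall (u : L1 k (vector_variation nu)) (g : T -> K),
      L1_val u = aeclass (vector_variation nu) (g : T -> K^o) ->
      bochner_val (M u) = aeclass mu (fun t => g t *: F t).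
Proof.
pose M : {linear L1 k (vector_variation nu) -> bochner mu X} :=
  HB.pack multiplication (GRing.isLinear.Build _ _ _ _ multiplication multiplication_linear).
exists M => u g uE; rewrite -[LHS]/(aeclass mu (fun x => L1_repr u x *: F x)).
apply/aeclassP; exact (eq_ae_scale nuF (L1_repr_ae uE)).
Qed.

End banach.

Theorem proposition4p6 (d : measure_display) (T : measurableType d)
    (R : realType) (k : scalar_kind) (mu : {measure set T -> \bar R})
    (X : completeNormedModType (scalar_field R k)) (F : T -> X)
    (nu : vector_measure mu X) :
  locally_determined mu ->
  locally_bochner_integrable mu F ->
  (forall B, finite_measure_sets mu B ->
     nu B = pettis_integral mu B (fun t => (\1_B t : scalar_field R k) *: F t)) ->
  (forall g : T -> scalar_field R k, scalar_measurable g ->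
     (L1_fun (vector_variation nu) g <->
      bochner_integrable mu (fun t => g t *: F t))) /\
  exists M : {linear L1 k (vector_variation nu) -> bochner mu X},
    [/\ forall (u : L1 k (vector_variation nu)) (g : T -> scalar_field R k),
          L1_fun (vector_variation nu) g ->
          L1_val u = aeclass (vector_variation nu) (g : T -> (scalar_field R k)^o) ->
          bochner_val (M u) = aeclass mu (fun t => g t *: F t),
        forall u : L1 k (vector_variation nu),
          norm1 (bochner_val (M u)) = norm1 (L1_val u) &
        forall u : L1 k (vector_variation nu),
          vector_measure_integral nu setT (L1_repr u) = bochner_integral (M u)].
Proof.
move=> _ lF nuE; have nuF := has_density_pettis lF nuE.
split=> [g mg|]; first exact: L1_fun_bochner.
have [M ME] := multiplication_exists nuF.
have MrE u : bochner_val (M u) = aeclass mu (fun t => L1_repr u t *: F t).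
  by apply: ME; rewrite L1_reprK.
have iM (u : L1 k (vector_variation nu)) : bochner_integrable mu (fun t => L1_repr u t *: F t).
  by have [mu_ _] := L1_reprP u; exact: (L1_fun_bochner nuF mu_).1 (L1_reprP u).
exists M; split => [u g _|u|u]; first exact: ME.
- rewrite MrE norm1E; last by apply: ae_measurable_rnorm; case: (iM u).
  by rewrite norm1_repr; apply: (norm_integral_scale nuF); case: (L1_reprP u).
- have [v uv] := has_integral_exists (iM u).
  rewrite (vector_measure_integralE nuF (L1_reprP u) uv) /bochner_integral.
  apply/esym/pettis_integralE; apply: has_integral_eq uv.
  by apply: ae_eq_sym; rewrite MrE; exact: repr_aeclass.
Qed.
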